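(* Let $(X,d_X)$ and $(Y,d_Y)$ be polyhedral Hilbert geometries in $\mathbb{R}^n$ and let $g\colon X\to Y$ be an isometry (onto). If $g$ extends to a continuous map $\overline X\to\overline Y$ and $g^{-1}$ extends to a continuous map $\overline Y\to\overline X$, then $g$ is a collineation, i.e. there is a projective transformation $h$ of $\mathbb{P}^n$ with $h(x)=g(x)$ for all $x\in X$.
   Context: A polyhedral Hilbert geometry is a nonempty bounded set $X\subseteq\mathbb{R}^n$ which is the intersection of finitely many open half-spaces, equipped with the Hilbert metric $d_X(x,y)=\log\frac{|x'y|\,|y'x|}{|x'x|\,|y'y|}$, where $x',y'\in\partial X$ are the endpoints of the chord through $x\neq y$ with $x',x,y,y'$ in this order, and $d_X(x,x)=0$. $\mathbb{R}^n$ is the standard affine chart of $\mathbb{P}^n$. *)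

(* Defs.v *)
From HB Require Import structures.
From mathcomp Require Import all_boot all_order all_algebra.
From mathcomp Require Import all_classical all_reals all_analysis.
Set Implicit Arguments. Unset Strict Implicit. Unset Printing Implicit Defensive.
Import Order.TTheory GRing.Theory Num.Theory.
Import numFieldNormedType.Exports.
Local Open Scope classical_set_scope.
Local Open Scope ring_scope.

Section HilbertDefs.
Variables (R : realType) (n : nat).
Notation V := 'rV[R]_n.

Definition dotp (u v : V) : R := \sum_(i < n) u 0 i * v 0 i.
Definition edist (x y : V) : R := Num.sqrt (dotp (x - y) (x - y)).

Definition open_halfspace (a : V) (b : R) : set V := [set x | dotp a x < b].

Definition polyhedral_hilbert (X : set V) : Prop :=
  [/\ X !=set0,
      (exists M : R, forall x, X x -> edist x 0 <= M) &
      exists (k : nat) (a : 'I_k -> V) (b : 'I_k -> R),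
        (forall i, a i != 0) /\ X = \bigcap_(i in [set: 'I_k]) open_halfspace (a i) (b i)].

Definition bdry (X : set V) : set V := closure X `\` interior X.

Definition chord_ends (X : set V) (x y : V) : set (V * V) :=
  [set p | bdry X p.1 /\ bdry X p.2 /\
     (exists s : R, s < 0 /\ p.1 = x + s *: (y - x)) /\
     (exists t : R, 1 < t /\ p.2 = x + t *: (y - x))].

Definition hilbert_dist (X : set V) (x y : V) : R :=
  if x == y then 0 else
  let p := xget (0, 0) (chord_ends X x y) in
  ln ((edist p.1 y * edist p.2 x) / (edist p.1 x * edist p.2 y)).

End HilbertDefs.

(* Main.v *)
(** Write X = {f_i > 0} and Y = {f'_j > 0} with affine f_i, f'_j. Then exp d(x, y) is the
    product of max_i f_i(x)/f_i(y) and max_i f_i(y)/f_i(x). Chords issuing from a vertex v of X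
    are unique geodesics, so g maps them to straight segments, which by continuity issue from
    the boundary point G(v); comparing distances, g is a projective map on each of them, fixing
    the direction from v: (x + tv)/(1 + t) is sent to (g x + t r G(v))/(1 + t r), where r > 0
    depends on v and x only.

    Choose affinely independent vertices v_0, ..., v_n. Their convex hull is mapped into that of
    the w_j = G(v_j), which are therefore affinely independent. In barycentric coordinates alpha
    and beta with respect to the v_j and the w_j, moving towards v_j only changes the j-th
    homogeneous coordinate, on both sides. Since moreover faces are mapped to faces,
    r alpha_j(x) = beta_j(g x) inside the simplex, and the ratio
    beta_i(g x) alpha_j(x) / (beta_j(g x) alpha_i(x)) is constant there. Finally any x in X
    reaches the simplex by moving towards the vertices, and the relation propagates backwards
    along these chords. Hence g is diagonal in homogeneous barycentric coordinates. *)

Require Import Defs.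
From HB Require Import structures.
From mathcomp Require Import all_boot all_order all_algebra.
From mathcomp Require Import all_classical all_reals all_analysis.
From mathcomp Require Import ring lra.
Import Order.TTheory GRing.Theory Num.Theory.
Import numFieldNormedType.Exports.
Set Implicit Arguments.
Unset Strict Implicit.
Unset Printing Implicit Defensive.
Local Open Scope classical_set_scope.
Local Open Scope ring_scope.

(** * The dot product *)

Section DotProduct.
Variables (R : realType) (n : nat).
Implicit Types (u v w : 'rV[R]_n) (c : R).

Lemma dotpC u v : dotp u v = dotp v u.
Proof. by apply: eq_bigr => i _; rewrite mulrC. Qed.

Lemma dotpDr u v w : dotp u (v + w) = dotp u v + dotp u w.
Proof. by rewrite -big_split; apply: eq_bigr => i _; rewrite mxE mulrDr. Qed.

Lemma dotpZr c u v : dotp u (c *: v) = c * dotp u v.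
Proof. by rewrite mulr_sumr; apply: eq_bigr => i _; rewrite mxE mulrCA. Qed.

Lemma dotpNr u v : dotp u (- v) = - dotp u v.
Proof. by rewrite -scaleN1r dotpZr mulN1r. Qed.

Lemma dotpBr u v w : dotp u (v - w) = dotp u v - dotp u w.
Proof. by rewrite dotpDr dotpNr. Qed.

Lemma dotp0r u : dotp u 0 = 0.
Proof. by rewrite -(scale0r u) dotpZr mul0r. Qed.

Definition dotpE := (dotpDr, dotpBr, dotpZr, dotpNr).

Lemma dotpZl c u v : dotp (c *: u) v = c * dotp u v.
Proof. by rewrite dotpC dotpZr dotpC. Qed.

Lemma dotpNl u v : dotp (- u) v = - dotp u v.
Proof. by rewrite dotpC dotpNr dotpC. Qed.

Lemma dotpBl u v w : dotp (v - w) u = dotp v u - dotp w u.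
Proof. by rewrite dotpC dotpBr !(dotpC u). Qed.

Lemma dotp_sumr u (I : Type) (s : seq I) (P : pred I) (F : I -> 'rV[R]_n) :
  dotp u (\sum_(i <- s | P i) F i) = \sum_(i <- s | P i) dotp u (F i).
Proof. by apply: (big_morph _ (dotpDr u)); rewrite dotp0r. Qed.

Lemma dotp_ge0 u : 0 <= dotp u u.
Proof. by apply: sumr_ge0 => i _; rewrite -expr2 sqr_ge0. Qed.

Lemma dotp_eq0 u : (dotp u u == 0) = (u == 0).
Proof.
apply/idP/eqP => [|->]; last by rewrite dotp0r.
rewrite psumr_eq0 => [|i _]; last by rewrite -expr2 sqr_ge0.
move=> /allP u0; apply/rowP => i; rewrite mxE.
by have := u0 i (mem_index_enum i); rewrite -expr2 sqrf_eq0 => /eqP.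
Qed.

Lemma dotp_gt0 u : u != 0 -> 0 < dotp u u.
Proof. by move=> u0; rewrite lt_neqAle eq_sym dotp_eq0 u0 dotp_ge0. Qed.

Lemma edist_line u v c c' :
  Defs.edist (u + c *: v) (u + c' *: v) = `|c - c'| * Num.sqrt (dotp v v).
Proof.
have -> : Defs.edist (u + c *: v) (u + c' *: v) =
    Num.sqrt ((c - c') ^+ 2 * dotp v v).
  rewrite /Defs.edist opprD addrACA subrr add0r -scalerBl dotpZl dotpZr.
  by rewrite mulrA expr2.
by rewrite sqrtrM ?sqr_ge0 // sqrtr_sqr.
Qed.

(* A point lies in the segment [p, q] as soon as every closed half-space containing both p
   and q contains it; the functional orthogonal to q - p forces it onto the line. *)
Lemma in_segment_halfspaces x p q :
  (forall u c, dotp u p <= c -> dotp u q <= c -> dotp u x <= c) ->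
  exists r, [/\ 0 <= r, r <= 1 & x = p + r *: (q - p)].
Proof.
move=> h; set d := q - p; pose r := dotp d (x - p) / dotp d d.
have hp u : 0 <= dotp u d -> dotp u (x - p) <= dotp u d.
  rewrite /d !dotpE => ud; have := h u (dotp u q); lra.
have hp0 u : dotp u d <= 0 -> dotp u (x - p) <= 0.
  rewrite /d !dotpE => ud; have := h u (dotp u p); lra.
have xr : x = p + r *: d.
  have ort : dotp (x - p - r *: d) d = 0.
    rewrite dotpBl dotpZl /r (dotpC (x - p)).
    have [->|d0] := eqVneq d 0; first by rewrite dotp0r dotpC dotp0r; ring.
    by rewrite divfK ?subrr // dotp_eq0.
  have : dotp (x - p - r *: d) (x - p - r *: d) <= 0.
    rewrite dotpBr dotpZr ort mulr0 subr0; apply: hp0.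
    by rewrite ort.
  rewrite le_eqVlt ltNge dotp_ge0 orbF dotp_eq0 => /eqP h0.
  by apply/eqP; rewrite -subr_eq0 opprD addrA h0.
have [d0|d0] := eqVneq d 0.
  exists 0; split=> //; rewrite ?ler01 //.
  by rewrite {1}xr d0 !scaler0.
have dd := dotp_gt0 d0.
exists r; split=> //; rewrite /r.
  rewrite divr_ge0 ?(ltW dd) //.
  have := hp0 (- d); rewrite !dotpNl; lra.
by rewrite ler_pdivrMr // mul1r hp // ltW.
Qed.

End DotProduct.

(** * The Hilbert metric of a polytope *)

Section Polytope.
Variables (R : realType) (n k : nat) (a : 'I_k -> 'rV[R]_n) (b : 'I_k -> R).
Implicit Types (x y z v w p q : 'rV[R]_n) (i j : 'I_k).

Definition slack i x := b i - dotp (a i) x.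
Definition open_polytope : set 'rV[R]_n := [set x | forall i, 0 < slack i x].
Definition closed_polytope : set 'rV[R]_n := [set x | forall i, 0 <= slack i x].
(** Boundedness of a nonempty polytope, read on the normals: along every direction some slack
    decreases, so no ray stays inside. *)
Definition positively_spanning := forall u : 'rV[R]_n, u != 0 -> exists i, 0 < dotp (a i) u.
(** The default 0 is harmless: all ratios are nonnegative when [x] is in the closed and [y] in the
    open polytope. *)
Definition max_ratio x y := \big[Num.max/0]_(i < k) (slack i x / slack i y).
(* The exponential of the Hilbert distance, max_ratio being that of the Funk distance. *)
Definition xratio x y := max_ratio x y * max_ratio y x.
(** Algebraic form of an extreme point: the normals of the facets through [v] span the whole
    space. *)
Definition vertex v := closed_polytope v /\
  forall u, (forall i, slack i v = 0 -> dotp (a i) u = 0) -> u = 0.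

Lemma open_polytopeE :
  open_polytope = \bigcap_(i in [set: 'I_k]) open_halfspace (a i) (b i).
Proof.
apply/seteqP; split=> x h i => [_|].
  by rewrite /open_halfspace /= -subr_gt0; apply: h.
by rewrite /slack subr_gt0; apply: (h i I).
Qed.

Lemma open_closed x : open_polytope x -> closed_polytope x.
Proof. by move=> xo i; apply: ltW. Qed.

Lemma slack_lerp i p q r :
  slack i (p + r *: (q - p)) = (1 - r) * slack i p + r * slack i q.
Proof. by rewrite /slack !dotpE; ring. Qed.

Lemma closed_lerp p q r : closed_polytope p -> closed_polytope q ->
  0 <= r -> r <= 1 -> closed_polytope (p + r *: (q - p)).
Proof.
move=> pc qc r0 r1 i; rewrite slack_lerp.
by rewrite addr_ge0 // mulr_ge0 // subr_ge0.
Qed.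

Lemma open_lerp p q r : closed_polytope p -> open_polytope q ->
  0 < r -> r <= 1 -> open_polytope (p + r *: (q - p)).
Proof.
move=> pc qc r0 r1 i; rewrite slack_lerp ltr_wpDl //.
  by rewrite mulr_ge0 // subr_ge0.
by rewrite mulr_gt0.
Qed.

Lemma boundary_active x : closed_polytope x -> ~ open_polytope x ->
  exists i, slack i x = 0.
Proof.
move=> xc xo; apply: contrapT => h; apply: xo => i.
rewrite lt_neqAle xc andbT eq_sym; apply/eqP => e; apply: h.
by exists i.
Qed.

(** A witness that there is a facet, so that [max_ratio] is attained by one of them. *)
Variable i0 : 'I_k.

Lemma ratio_ge i x y : slack i x / slack i y <= max_ratio x y.
Proof. exact: le_bigmax. Qed.

Lemma ratioP x y : closed_polytope x -> open_polytope y ->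
  exists i, max_ratio x y = slack i x / slack i y.
Proof.
move=> xc yo; eexists; apply: (bigmax_eq_arg _ i0) => // i _.
by rewrite divr_ge0 // ltW.
Qed.

Lemma ratio_le x y c : closed_polytope x -> open_polytope y ->
  (forall i, slack i x <= c * slack i y) -> max_ratio x y <= c.
Proof.
move=> xc yo h; have [i ->] := ratioP xc yo.
by rewrite ler_pdivrMr.
Qed.

Lemma slack_le_ratio i x y : open_polytope y ->
  slack i x <= max_ratio x y * slack i y.
Proof. by move=> yo; rewrite -ler_pdivrMr // ratio_ge. Qed.

Lemma ratio_eq i x y c : closed_polytope x -> open_polytope y ->
  (forall j, slack j x <= c * slack j y) -> slack i x = c * slack i y ->
  max_ratio x y = c.
Proof.
move=> xc yo h e; apply/le_anti; rewrite ratio_le //=.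
by apply: le_trans (ratio_ge i x y); rewrite e mulfK // gt_eqF.
Qed.

Lemma ratio_gt0 x y : open_polytope x -> open_polytope y -> 0 < max_ratio x y.
Proof.
move=> xo yo; apply: lt_le_trans (ratio_ge i0 x y).
by rewrite divr_gt0.
Qed.

Lemma ratio_refl x : open_polytope x -> max_ratio x x = 1.
Proof.
move=> xo; apply: (ratio_eq (i := i0)); rewrite ?mul1r //.
  exact: open_closed.
by move=> j; rewrite mul1r.
Qed.

Hypothesis pted : positively_spanning.

Lemma ratio_gt1 x y : open_polytope y -> x != y -> 1 < max_ratio x y.
Proof.
move=> yo xy; have [|i hi] := pted (u := y - x); first by rewrite subr_eq0 eq_sym.
apply: lt_le_trans (ratio_ge i x y).
rewrite ltr_pdivlMr // mul1r /slack ltrD2l ltrN2.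
by rewrite -subr_gt0 -dotpBr.
Qed.

Lemma ratio_ge1 x y : open_polytope y -> 1 <= max_ratio x y.
Proof.
move=> yo; have [->|xy] := eqVneq x y; first by rewrite ratio_refl.
by apply/ltW/ratio_gt1.
Qed.

(** Multiplicative triangle inequality of the Funk distance, obtained facet by facet. *)
Lemma ratio_trans x y z : open_polytope x -> open_polytope y ->
  open_polytope z -> max_ratio x y <= max_ratio x z * max_ratio z y.
Proof.
move=> xo yo zo; apply: ratio_le => // [|i]; first exact: open_closed.
apply: le_trans (slack_le_ratio i x zo) _.
rewrite -mulrA ler_wpM2l ?slack_le_ratio //.
exact/ltW/ratio_gt0.
Qed.

Lemma xratio_ge1 x y : open_polytope x -> open_polytope y -> 1 <= xratio x y.
Proof.
move=> xo yo; have := ratio_ge1 x yo; have := ratio_ge1 y xo.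
rewrite /xratio; nra.
Qed.

(** The inverse ratio of facet [j] is affine in [r] with slope determined by
    [slack j q / slack j p], so the facet attaining the maximum at [q] attains it all along the
    segment. *)
Lemma ratio_segl p q r : open_polytope p -> open_polytope q ->
  0 <= r -> r <= 1 ->
  max_ratio p (p + r *: (q - p)) = (1 - r + r / max_ratio p q)^-1.
Proof.
move=> po qo r0 r1; have [i hi] := ratioP (open_closed po) qo.
have m0 : 0 < (max_ratio p q)^-1 by rewrite invr_gt0 ratio_gt0.
have d0 : 0 < 1 - r + r / max_ratio p q.
  have := r0; rewrite le_eqVlt => /orP[/eqP<-|rp]; first lra.
  have : 0 < r / max_ratio p q by apply: mulr_gt0.
  by lra.
apply: (ratio_eq (i := i)).
- exact: open_closed.
- have := r0; rewrite le_eqVlt => /orP[/eqP<-|rp].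
    by rewrite scale0r addr0.
  by apply: open_lerp => //; apply: open_closed.
- move=> j; rewrite slack_lerp mulrC ler_pdivlMr //.
  have := slack_le_ratio j p qo; rewrite -ler_pdivrMl ?ratio_gt0 //.
  move=> h; rewrite mulrDr.
  have -> : slack j p * (1 - r) + slack j p * (r / max_ratio p q) =
    (1 - r) * slack j p + r * ((max_ratio p q)^-1 * slack j p) by ring.
  by rewrite lerD2l ler_wpM2l.
- rewrite slack_lerp; apply: (canRL (mulKf (lt0r_neq0 d0))).
  have -> : slack i p = max_ratio p q * slack i q by rewrite hi divfK ?gt_eqF.
  by field; rewrite gt_eqF // ratio_gt0.
Qed.

Lemma ratio_segr p q r : open_polytope p -> open_polytope q ->
  0 <= r -> r <= 1 ->
  max_ratio (p + r *: (q - p)) p = 1 - r + r * max_ratio q p.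
Proof.
move=> po qo r0 r1; have [i hi] := ratioP (open_closed qo) po.
apply: (ratio_eq (i := i)) => //.
- by apply: closed_lerp => //; apply: open_closed.
- move=> j; rewrite slack_lerp [leRHS]mulrDl lerD2l -mulrA ler_wpM2l //.
  exact: slack_le_ratio.
- by rewrite slack_lerp hi; field; rewrite gt_eqF.
Qed.

(** Straight segments are geodesics: the explicit formulas from [p], and from [q] on the reversed
    segment, multiply to the full ratio. *)
Lemma xratio_between p q r : open_polytope p -> open_polytope q ->
  0 <= r -> r <= 1 ->
  xratio p (p + r *: (q - p)) * xratio (p + r *: (q - p)) q = xratio p q.
Proof.
move=> po qo r0 r1.
have e : p + r *: (q - p) = q + (1 - r) *: (p - q).
  by apply/rowP => i; rewrite !mxE; ring.
have r0' : 0 <= 1 - r by lra.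
have r1' : 1 - r <= 1 by lra.
rewrite /xratio ratio_segl // ratio_segr // e ratio_segl // ratio_segr //.
have m0 := ratio_gt0 po qo; have n0 := ratio_gt0 qo po.
have d0 : 0 < (1 - r) * max_ratio p q + r.
  by have := ratio_ge1 p qo; nra.
have d1 : 0 < r * max_ratio q p + (1 - r).
  by have := ratio_ge1 q po; nra.
by field; rewrite !gt_eqF //; lra.
Qed.

Lemma xratio_ivt p q e : open_polytope p -> open_polytope q ->
  1 <= e -> e <= xratio p q ->
  exists r, [/\ 0 <= r, r <= 1 & xratio p (p + r *: (q - p)) = e].
Proof.
move=> po qo e1 eq; have [epq|pq] := eqVneq p q.
  exists 0; split=> //; move: eq; rewrite scale0r addr0 -epq /xratio.
  by rewrite ratio_refl // mulr1 => h; apply/le_anti; rewrite e1.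
have m1 := ratio_gt1 qo pq.
have n1 : 1 < max_ratio q p by apply: ratio_gt1 => //; rewrite eq_sym.
move: eq; rewrite /xratio; set m := max_ratio p q in m1 *.
set N := max_ratio q p in n1 * => eq.
have d0 : 0 < N - 1 + e * (1 - m^-1).
  have : 0 < 1 - m^-1 by rewrite subr_gt0 invf_lt1 //; lra.
  by nra.
(* Solution of [(1 - r + r * N) / (1 - r + r / m) = e], which is linear in [r]. *)
pose r := (e - 1) / (N - 1 + e * (1 - m^-1)).
have r0 : 0 <= r by rewrite divr_ge0 ?(ltW d0) // subr_ge0.
have r1 : r <= 1.
  rewrite ler_pdivrMr // mul1r.
  have : e / m <= N by rewrite ler_pdivrMr 1?mulrC //; lra.
  by lra.
exists r; split=> //.
rewrite ratio_segl // ratio_segr // -/m -/N /r.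
have m0 : m != 0 by apply: lt0r_neq0; lra.
by field; rewrite m0 /=; apply/andP; split; apply: lt0r_neq0; nra.
Qed.

(* The point dividing the chord from x to v: it is x at t = 0 and tends to v as t tends to
   infinity. *)
Definition chord x v (t : R) := (1 + t)^-1 *: (x + t *: v).

Lemma chord_lerp x v t : 1 + t != 0 ->
  chord x v t = v + (1 + t)^-1 *: (x - v).
Proof. by move=> t1; apply/rowP => i; rewrite !mxE; field. Qed.

Lemma lerp_chord x v r : 1 - r != 0 -> x + r *: (v - x) = chord x v (r / (1 - r)).
Proof.
move=> r1; apply/rowP => i; rewrite !mxE; field.
by rewrite r1 subrK oner_eq0.
Qed.

Lemma slack_chord i x v t : 1 + t != 0 ->
  slack i (chord x v t) = (slack i x + t * slack i v) / (1 + t).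
Proof. by move=> t1; rewrite /slack dotpZr !dotpE; field. Qed.

Lemma chord_open x v t : open_polytope x -> closed_polytope v -> 0 <= t ->
  open_polytope (chord x v t).
Proof.
move=> xo vc t0 i; rewrite slack_chord; last by rewrite lt0r_neq0 //; lra.
rewrite divr_gt0 //; last lra.
by rewrite ltr_pwDl // mulr_ge0.
Qed.

(** * Distances along chords to a boundary point *)

Section BoundaryPoint.
Variables (w : 'rV[R]_n) (j0 : 'I_k).
Hypotheses (wc : closed_polytope w) (w0 : slack j0 w = 0).

(** On a facet through [w] the slack is divided by exactly [1 + t]; on the other facets it shrinks
    by no more than that. *)
Lemma ratio_chordr x t : open_polytope x -> 0 <= t ->
  max_ratio x (chord x w t) = 1 + t.
Proof.
move=> xo t0; have t1 : 0 < 1 + t by lra.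
have t1' := lt0r_neq0 t1.
apply: (ratio_eq (i := j0)).
- exact: open_closed.
- exact: chord_open.
- move=> j; rewrite slack_chord // mulrC divfK //.
  by rewrite lerDl mulr_ge0.
- by rewrite slack_chord // w0 mulr0 addr0 mulrC divfK.
Qed.

Lemma ratio_chordl x t : open_polytope x -> 0 <= t ->
  max_ratio (chord x w t) x = (1 + t * max_ratio w x) / (1 + t).
Proof.
move=> xo t0; have t1 : 0 < 1 + t by lra.
have t1' := lt0r_neq0 t1.
have [i hi] := ratioP wc xo.
apply: (ratio_eq (i := i)) => //.
- by apply/open_closed/chord_open.
- move=> j; rewrite slack_chord // mulrAC ler_pM2r ?invr_gt0 //.
  by rewrite mulrDl mul1r lerD2l -mulrA ler_wpM2l // slack_le_ratio.
- by rewrite slack_chord // hi; field; rewrite t1' gt_eqF.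
Qed.

(** The exponential of the distance is affine in the chord parameter; comparing such formulas in
    source and target matches the parameters. *)
Lemma xratio_chord x t : open_polytope x -> 0 <= t ->
  xratio x (chord x w t) = 1 + t * max_ratio w x.
Proof.
move=> xo t0; rewrite /xratio ratio_chordr // ratio_chordl // mulrC divfK //.
by rewrite lt0r_neq0 //; lra.
Qed.

Lemma boundary_ratio_gt1 x : open_polytope x -> 1 < max_ratio w x.
Proof.
move=> xo; apply: ratio_gt1 => //; apply/eqP => e.
by have := xo j0; rewrite -e w0 ltxx.
Qed.

End BoundaryPoint.

(** Here [t] may be negative, which is how chords are followed away from [v]. The same facet attains
    both maxima, as the new ratio is an increasing function of the old one. *)
Lemma ratio_chord_shift v x t : closed_polytope v -> open_polytope x ->
  0 < 1 + t -> open_polytope (chord x v t) ->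
  0 < 1 + t * max_ratio v x /\
  max_ratio v (chord x v t) = (1 + t) * max_ratio v x / (1 + t * max_ratio v x).
Proof.
move=> vc xo t1 yo; have [i hi] := ratioP vc xo.
have t1' := lt0r_neq0 t1.
have d0 : 0 < 1 + t * max_ratio v x.
  have := yo i; rewrite slack_chord // pmulr_lgt0 ?invr_gt0 //.
  rewrite hi => h.
  have -> : 1 + t * (slack i v / slack i x) =
    (slack i x + t * slack i v) / slack i x by field; rewrite gt_eqF.
  by rewrite divr_gt0.
split=> //; apply: (ratio_eq (i := i)) => //.
- move=> j; rewrite slack_chord //.
  have -> : (1 + t) * max_ratio v x / (1 + t * max_ratio v x) *
    ((slack j x + t * slack j v) / (1 + t)) =
    max_ratio v x * (slack j x + t * slack j v) / (1 + t * max_ratio v x).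
    by field; rewrite t1' gt_eqF.
  rewrite ler_pdivlMr //; have := slack_le_ratio j v xo.
  lra.
- rewrite slack_chord //.
  have -> : slack i v = max_ratio v x * slack i x by rewrite hi divfK // gt_eqF.
  by field; rewrite t1' gt_eqF.
Qed.

(* Equality in the triangle inequality forces all constraints active at v to be scaled by
   the same factor between x and z. *)
Lemma vertex_geodesic v x z t : vertex v -> open_polytope x -> open_polytope z ->
  0 <= t -> xratio x z * xratio z (chord x v t) = xratio x (chord x v t) ->
  z = chord x v (max_ratio x z - 1).
Proof.
move=> [vc vx] xo zo t0 e; set y := chord x v t in e *.
have yo : open_polytope y by apply: chord_open.
have t1 : 0 < 1 + t by lra.
(* Both Funk distances satisfy the triangle inequality, so equality for their product forces
   equality in each. *)
have e1 : max_ratio x z * max_ratio z y = max_ratio x y.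
  have := ratio_trans xo yo zo; have := ratio_trans yo xo zo; move: e.
  rewrite /xratio.
  have := ratio_gt0 xo yo; have := ratio_gt0 yo xo; have := ratio_gt0 xo zo.
  have := ratio_gt0 yo zo; have := ratio_gt0 zo yo; have := ratio_gt0 zo xo.
  move: (max_ratio x z) (max_ratio z y) (max_ratio x y) (max_ratio z x)
    (max_ratio y z) (max_ratio y x).
  move=> A B C A' B' C' *; apply/le_anti/andP; split=> //.
  rewrite leNgt; apply/negP => h.
  have : C * C' < A * B * (B' * A').
    apply: (@lt_le_trans _ _ (A * B * C')); first by rewrite ltr_pM2r.
    by rewrite ler_pM2l ?mulr_gt0.
  by nra.
have m0 := ratio_gt0 xo zo.
have act i : slack i v = 0 -> slack i x = max_ratio x z * slack i z.
  move=> iv; apply/le_anti; rewrite slack_le_ratio //=.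
  have h1 : slack i x = (1 + t) * slack i y.
    by rewrite slack_chord ?lt0r_neq0 // iv mulr0 addr0 mulrC divfK ?lt0r_neq0.
  rewrite h1 -(ratio_chordr vc iv xo t0) -e1 -mulrA ler_pM2l //.
  exact: slack_le_ratio.
apply/eqP; rewrite -subr_eq0; apply/eqP/vx => i iv.
have : slack i z = slack i (chord x v (max_ratio x z - 1)).
  have e2 : 1 + (max_ratio x z - 1) = max_ratio x z by ring.
  rewrite slack_chord e2 ?lt0r_neq0 // iv mulr0 addr0 act //.
  by rewrite mulrC mulKf ?lt0r_neq0.
by rewrite /slack dotpBr => /addrI/oppr_inj->; rewrite subrr.
Qed.

End Polytope.

(** * Topology of polytopes and existence of vertices *)

Section Continuity.
Variables (R : realType) (n : nat).
Implicit Types (u p q : 'rV[R]_n).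

Lemma continuous_dotp (f g : 'rV[R]_n -> 'rV[R]_n) :
  (forall i, continuous (fun x => f x 0 i)) ->
  (forall i, continuous (fun x => g x 0 i)) ->
  continuous (fun x => dotp (f x) (g x)).
Proof.
move=> cf cg; apply: continuous_big => [|i _]; first exact: add_continuous.
by move=> x; apply: continuousM; [exact: cf|exact: cg].
Qed.

Lemma continuous_dotpl u : continuous (dotp u).
Proof.
by apply: continuous_dotp => i; [exact: cst_continuous|exact: coord_continuous].
Qed.

Lemma nbhs_line p q (U : set 'rV[R]_n) : nbhs p U ->
  exists d : R, [/\ 0 < d, d <= 1 &
    forall s, 0 <= s -> s <= d -> U (p + s *: (q - p))].
Proof.
move=> /nbhs_ballP[e /= e0 eU].
(* A bound for all coordinates of [q - p], kept positive by the summand 1. *)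
pose B := 1 + \sum_i `|(q - p) 0 i|.
have B1 : 1 <= B by rewrite lerDl sumr_ge0.
have Bi i : `|(q - p) 0 i| < B.
  rewrite /B (bigD1 i) //= ltr_pwDl // lerDl.
  by rewrite sumr_ge0.
exists (Num.min 1 (e / B)); split; first by rewrite lt_min ltr01 divr_gt0 //; lra.
  by rewrite ge_min lexx.
move=> s s0; rewrite le_min => /andP[_ sd]; apply: eU; split=> // i j.
rewrite !ord1 /ball /= !mxE opprD addrA subrr add0r normrN normrM ger0_norm //.
have := Bi j; rewrite !mxE => h.
have [->|s00] := eqVneq s 0; first by rewrite mul0r.
apply: (@lt_le_trans _ _ (s * B)); last by rewrite -ler_pdivlMr //; lra.
by rewrite ltr_pM2l // lt_neqAle eq_sym s00.
Qed.

Lemma within_continuous_nbhs_line (A : set 'rV[R]_n) (F : 'rV[R]_n -> 'rV[R]_n)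
    p q (U : set 'rV[R]_n) : {within A, continuous F} ->
  (forall s, 0 <= s -> s <= 1 -> A (p + s *: (q - p))) -> nbhs (F p) U ->
  exists d : R, [/\ 0 < d, d <= 1 & forall s, 0 <= s -> s <= d ->
    U (F (p + s *: (q - p)))].
Proof.
move=> /subspace_continuousP cF segA FU.
have pA : A p by have := segA 0 (lexx _) ler01; rewrite scale0r addr0.
have /nbhs_line-/(_ q)[d [d0 d1 h]] := cF p pA U FU.
exists d; split=> // s s0 sd; apply: h => //.
by apply: segA => //; apply: le_trans d1.
Qed.

Lemma within_continuous_line (A : set 'rV[R]_n) (F : 'rV[R]_n -> 'rV[R]_n)
    p q u e : {within A, continuous F} ->
  (forall s, 0 <= s -> s <= 1 -> A (p + s *: (q - p))) -> 0 < e ->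
  exists d : R, [/\ 0 < d, d <= 1 & forall s, 0 <= s -> s <= d ->
    `|dotp u (F (p + s *: (q - p))) - dotp u (F p)| < e].
Proof.
move=> cF segA e0.
apply: (within_continuous_nbhs_line
  (U := [set z | `|dotp u z - dotp u (F p)| < e]) cF segA).
have /cvgrPdist_lt/(_ _ e0) := @continuous_dotpl u (F p).
by apply: (@filterS _ (nbhs (F p)) (@nbhs_filter _ (F p))) => z; rewrite distrC.
Qed.

End Continuity.

Section PolytopeTopology.
Variables (R : realType) (n k : nat) (a : 'I_k -> 'rV[R]_n) (b : 'I_k -> R).
Local Notation X := (open_polytope a b).
Local Notation cX := (closed_polytope a b).

Lemma continuous_slack i : continuous (slack a b i).
Proof.
move=> x; apply: (continuousB (f := cst (b i))); first exact: cst_continuous.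
exact: continuous_dotpl.
Qed.

Lemma open_open_polytope : open X.
Proof.
rewrite openE => x xX.
suff : \forall y \near x, forall i, 0 < slack a b i y by [].
apply: (@filter_forall _ _ (fun i y => 0 < slack a b i y) (nbhs x) (@nbhs_filter _ x)) => i.
exact: (cvgr_gt _ (@continuous_slack i x) _ (xX i)).
Qed.

Lemma closed_closed_polytope : closed cX.
Proof.
have -> : cX = \bigcap_(i in [set: 'I_k]) (slack a b i @^-1` [set y | 0 <= y]).
  by apply/seteqP; split => x h i; [move=> _; exact: h|exact: (h i I)].
apply: closed_bigI => i _; apply: closed_comp; last exact: closed_ge.
by move=> x _; apply: continuous_slack.
Qed.

Hypothesis X0 : X !=set0.

Lemma closure_open_polytope : closure X = cX.
Proof.
apply/seteqP; split.
  rewrite [X in _ `<=` X]((closure_id _).1 closed_closed_polytope).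
  by apply: closureS => x; apply: open_closed.
have [x0 x0X] := X0; move=> x xX U xU.
have [d [d0 d1 h]] := nbhs_line x0 xU.
exists (x + d *: (x0 - x)); split; last by apply: h => //; apply: ltW.
exact: open_lerp.
Qed.

Lemma bdry_open_polytope x : bdry X x <-> cX x /\ exists i, slack a b i x = 0.
Proof.
rewrite /bdry closure_open_polytope; have /interior_id-> := open_open_polytope.
split=> [[xc xo]|[xc [i xi]]].
  by split=> //; apply: boundary_active.
by split=> // /(_ i); rewrite xi ltxx.
Qed.

Variable M : R.
Hypothesis XM : forall x, X x -> Defs.edist x 0 <= M.

Lemma coord_bound x i : X x -> `|x 0 i| <= M.
Proof.
move=> /XM; apply: le_trans; rewrite /Defs.edist subr0 -sqrtr_sqr.
rewrite ler_sqrt ?dotp_ge0 // /dotp (bigD1 i) //= expr2 lerDl.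
by apply: sumr_ge0 => j _; rewrite -expr2 sqr_ge0.
Qed.

(** Otherwise the ray from [x0] along [u] stays in the polytope, and a coordinate with [u 0 i != 0]
    eventually exceeds the bound [M]. *)
Lemma bounded_positively_spanning : positively_spanning a.
Proof.
move=> u u0; apply: contrapT => h.
have [x0 x0X] := X0.
have [i ui] : exists i, u 0 i != 0.
  apply: contrapT => h1; case/eqP: u0; apply/rowP => i; rewrite mxE.
  by apply/eqP; apply: contra_notT h1 => ui; exists i.
have xr r : 0 <= r -> X (x0 + r *: u).
  move=> r0 j; rewrite /slack !dotpE opprD addrA.
  rewrite ltr_wpDr //; last exact: x0X.
  rewrite -mulrN mulr_ge0 // oppr_ge0 leNgt.
  by apply/negP => hj; apply: h; exists j.
have M0 : 0 <= M by apply: le_trans (normr_ge0 _) (coord_bound i x0X).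
have ua : 0 < `|u 0 i| by rewrite normr_gt0.
pose r := (M + `|x0 0 i| + 1) / `|u 0 i|.
have r0 : 0 <= r.
  by rewrite divr_ge0 // addr_ge0 // addr_ge0.
have := coord_bound i (xr _ r0); rewrite !mxE => h2.
have := ler_normB (x0 0 i + r * u 0 i) (x0 0 i).
rewrite addrC addKr normrM (ger0_norm r0) /r divfK ?gt_eqF //.
lra.
Qed.

Lemma compact_closed_polytope : compact cX.
Proof.
have cb : compact [set x : 'rV[R]_n | forall i, `[- M, M]%classic (x ord0 i)].
  by apply: (@rV_compact _ _ (fun=> `[- M, M]%classic)) => i; apply: segment_compact.
apply: subclosed_compact cb _; first exact: closed_closed_polytope.
rewrite -closure_open_polytope => x xX i.
rewrite /= in_itv /= -ler_norml leNgt; apply/negP => h.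
have [|y [yX]] := xX [set y : 'rV[R]_n | M < `|y 0 i|].
  have c : continuous (fun y : 'rV[R]_n => `|y 0 i|).
    move=> z; apply: (@cvg_comp _ _ _ (fun y : 'rV[R]_n => y 0 i)).
      exact: coord_continuous.
    exact: norm_continuous.
  by exact: (cvgr_gt _ (c x) _ h).
by rewrite /= ltNge coord_bound.
Qed.

(* A maximiser of the strictly convex function K * l^2 + |.|^2 over the polytope is a
   vertex; for K large it does not lie on the hyperplane l = 0. *)
Lemma vertex_off_hyperplane c (d : R) x0 : cX x0 -> dotp c x0 + d != 0 ->
  exists v, vertex a b v /\ dotp c v + d != 0.
Proof.
move=> x0c l0; pose l x := dotp c x + d.
have cl : continuous l.
  move=> x; apply: (continuousD (f := dotp c) (g := cst d)).
    exact: continuous_dotpl.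
  exact: cst_continuous.
have cq0 : continuous (fun x : 'rV[R]_n => dotp x x).
  by apply: continuous_dotp => i; apply: coord_continuous.
have cX0 : cX !=set0 by exists x0.
have [w wc wmax] := compact_EVT_max cX0 compact_closed_polytope
  (continuous_subspaceT cq0).
(* Chosen so that [K * l x0 ^+ 2] exceeds the maximum of the squared norm: a point with [l = 0] then
   loses against [x0]. *)
pose K := (dotp w w + 1) / l x0 ^+ 2.
have l2 : 0 < l x0 ^+ 2 by rewrite lt_neqAle sqr_ge0 andbT eq_sym sqrf_eq0.
have K0 : 0 <= K by rewrite divr_ge0 ?addr_ge0 ?dotp_ge0 // ltW.
pose q x := K * l x ^+ 2 + dotp x x.
have cq : continuous q.
  move=> x.
  apply: (continuousD (f := fun x => K * l x ^+ 2) (g := fun x => dotp x x)).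
    apply: (continuousM (s := cst K) (t := fun x => l x ^+ 2)).
      exact: cst_continuous.
    by apply: (continuousM (s := l) (t := l)); apply: cl.
  exact: cq0.
have [v vc vmax] := compact_EVT_max cX0 compact_closed_polytope
  (continuous_subspaceT cq).
rewrite inE in vc.
exists v; split; last first.
  apply/eqP => lv; have := vmax x0; rewrite inE => /(_ x0c).
  have lv0 : l v = 0 by []. rewrite /q /K lv0 divfK ?gt_eqF // expr0n mulr0 add0r.
  have := wmax v; rewrite inE => /(_ vc); have := dotp_ge0 x0.
  by lra.
split=> // u hu; apply/eqP; apply: contrapT => /negP u0.
have uu := dotp_gt0 u0.
(* A direction orthogonal to all active normals can be followed a little inside the polytope; this
   is applied to [u] and to [- u]. *)
have push (u' : 'rV[R]_n) : (forall i, slack a b i v = 0 -> dotp (a i) u' = 0) ->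
  exists e : R, 0 < e /\ forall s, 0 <= s -> s <= e -> cX (v + s *: u').
  move=> hu'.
  have : \forall z \near v, forall i, slack a b i v != 0 -> 0 < slack a b i z.
    apply: (@filter_forall _ _ (fun i z => slack a b i v != 0 ->
      0 < slack a b i z) (nbhs v) (@nbhs_filter _ v)) => i.
    have [si|si] := eqVneq (slack a b i v) 0.
      by apply: (@filterE _ (nbhs v) (@nbhs_filter _ v)).
    have v0 : 0 < slack a b i v by rewrite lt_neqAle eq_sym si vc.
    have h : nbhs v [set z | 0 < slack a b i z].
      exact: (cvgr_gt _ (@continuous_slack i v) _ v0).
    by apply: (@filterS _ (nbhs v) (@nbhs_filter _ v) _ _ _ h) => z.
  move=> /nbhs_line-/(_ (v + u'))[e [e0 _ he]]; exists e; split=> // s s0 se i.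
  have [si|si] := eqVneq (slack a b i v) 0.
    by rewrite /slack !dotpE hu' // mulr0 addr0 -/(slack a b i v) si.
  have e1 : v + u' - v = u' by rewrite addrC addKr.
  by have := he s s0 se i si; rewrite e1 => /ltW.
have [e1 [e10 h1]] := push u hu.
have [e2 [e20 h2]] : exists e : R, 0 < e /\ forall s, 0 <= s -> s <= e ->
    cX (v + s *: (- u)).
  by apply: push => i si; rewrite dotpNr hu // oppr0.
pose s := Num.min e1 e2.
have s0 : 0 < s by rewrite lt_min e10.
have := vmax (v + s *: u); rewrite inE => /(_ (h1 _ (ltW s0) _)).
rewrite ge_min lexx => /(_ isT).
have := vmax (v + s *: - u); rewrite inE => /(_ (h2 _ (ltW s0) _)).
rewrite ge_min lexx orbT => /(_ isT).
(* Adding the two maximality inequalities cancels the terms linear in [s] and leaves a positive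
   quadratic part, a contradiction. *)
have bi (x y : 'rV[R]_n) (r : R) : dotp (x + r *: y) (x + r *: y) =
  dotp x x + 2 * r * dotp x y + r ^+ 2 * dotp y y.
  rewrite dotpDr dotpZr !(dotpC (x + _)) !dotpE (dotpC y x); ring.
rewrite /q /l !bi !dotpE (dotpC (- u)) dotpNr.
have : 0 < s ^+ 2 * dotp u u by rewrite mulr_gt0 // exprn_gt0.
have : 0 <= K * (s * dotp c u) ^+ 2 by rewrite mulr_ge0 // sqr_ge0.
move: (dotp c v) (dotp c u) (dotp v v) (dotp v u) (dotp u u) => A B C D E.
lra.
Qed.

Hypothesis n0 : (0 < n)%N.

Lemma has_facet : exists i0 : 'I_k, True.
Proof.
have [i _] : exists i, 0 < dotp (a i) (const_mx 1).
  apply: bounded_positively_spanning; apply/eqP => /rowP/(_ (Ordinal n0))/eqP.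
  by rewrite !mxE oner_eq0.
by exists i.
Qed.

(** The endpoint of the chord behind [x] lies on the facets where [slack i y / slack i x] is
    largest, the endpoint beyond [y] on those where the inverse ratio is. The two factors of the
    cross-ratio are these two maxima. *)
Lemma hilbert_distE x y : X x -> X y -> hilbert_dist X x y = ln (xratio a b x y).
Proof.
move=> xX yX; rewrite /hilbert_dist; have [i0 _] := has_facet.
have ptd := bounded_positively_spanning.
case: eqVneq => [->|xy]; first by rewrite /xratio ratio_refl // mulr1 ln1.
have bd r p : p = x + r *: (y - x) -> bdry X p ->
   (forall i, 0 <= (1 - r) * slack a b i x + r * slack a b i y) /\
   exists i, (1 - r) * slack a b i x + r * slack a b i y = 0.
  move=> -> /bdry_open_polytope[h [i hi]]; split=> [j|].
    by rewrite -slack_lerp.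
  by exists i; rewrite -slack_lerp.
have m1 : 1 < max_ratio a b x y by apply: ratio_gt1.
have M1 : 1 < max_ratio a b y x by apply: ratio_gt1; rewrite // eq_sym.
have [p pE] : exists p, chord_ends X x y p.
  have [i hi] := ratioP i0 (open_closed yX) xX.
  have [j hj] := ratioP i0 (open_closed xX) yX.
  have ri (l : 'I_k) := slack_le_ratio l y xX.
  have rj (l : 'I_k) := slack_le_ratio l x yX.
  (* The parameters at which the slacks of the maximising facets [i] and [j] vanish on the line
     through [x] and [y]. *)
  pose s := - (max_ratio a b y x - 1)^-1.
  pose t := max_ratio a b x y / (max_ratio a b x y - 1).
  exists (x + s *: (y - x), x + t *: (y - x)).
  split; [|split; [|split]] => /=.
  - apply/bdry_open_polytope; split=> [l|].
      rewrite slack_lerp.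
      have -> : (1 - s) * slack a b l x + s * slack a b l y =
        (max_ratio a b y x * slack a b l x - slack a b l y) / (max_ratio a b y x - 1).
        by rewrite /s; field; rewrite lt0r_neq0 // subr_gt0.
      by rewrite divr_ge0 // subr_ge0 // ltW.
    exists i; rewrite slack_lerp.
    have -> : (1 - s) * slack a b i x + s * slack a b i y =
        (max_ratio a b y x * slack a b i x - slack a b i y) / (max_ratio a b y x - 1).
      by rewrite /s; field; rewrite lt0r_neq0 // subr_gt0.
    by rewrite hi divfK ?gt_eqF // subrr mul0r.
  - apply/bdry_open_polytope; split=> [l|].
      rewrite slack_lerp.
      have -> : (1 - t) * slack a b l x + t * slack a b l y =
        (max_ratio a b x y * slack a b l y - slack a b l x) / (max_ratio a b x y - 1).
        by rewrite /t; field; rewrite lt0r_neq0 // subr_gt0.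
      by rewrite divr_ge0 // subr_ge0 // ltW.
    exists j; rewrite slack_lerp.
    have -> : (1 - t) * slack a b j x + t * slack a b j y =
        (max_ratio a b x y * slack a b j y - slack a b j x) / (max_ratio a b x y - 1).
      by rewrite /t; field; rewrite lt0r_neq0 // subr_gt0.
    by rewrite hj divfK ?gt_eqF // subrr mul0r.
  - by exists s; split=> //; rewrite oppr_lt0 invr_gt0 subr_gt0.
  - by exists t; split=> //; rewrite ltr_pdivlMr ?subr_gt0 //; lra.
(* The default of [xget] is ruled out by the pair just built; the computation below applies to
   whichever pair is chosen. *)
have : chord_ends X x y (xget (0, 0) (chord_ends X x y)).
  by apply: xgetPex; exists p.
move: (xget _ _) => {p pE}p.
move=> [b1 [b2 [[s [s0 ps]] [t [t1 pt]]]]].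
have u0 : Num.sqrt (dotp (y - x) (y - x)) != 0.
  by rewrite gt_eqF // sqrtr_gt0 dotp_gt0 // subr_eq0 eq_sym.
have ey : y = x + 1 *: (y - x) by rewrite scale1r addrC subrK.
have ex : x = x + 0 *: (y - x) by rewrite scale0r addr0.
have D1 : Defs.edist p.1 y = `|s - 1| * Num.sqrt (dotp (y - x) (y - x)).
  by rewrite ps {2}ey edist_line.
have D2 : Defs.edist p.2 x = `|t - 0| * Num.sqrt (dotp (y - x) (y - x)).
  by rewrite pt {3}ex edist_line.
have D3 : Defs.edist p.1 x = `|s - 0| * Num.sqrt (dotp (y - x) (y - x)).
  by rewrite ps {3}ex edist_line.
have D4 : Defs.edist p.2 y = `|t - 1| * Num.sqrt (dotp (y - x) (y - x)).
  by rewrite pt {2}ey edist_line.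
have s1 : s - 1 < 0 by lra.
have t1' : 0 < t - 1 by lra.
have t0 : 0 < t by lra.
rewrite D1 D2 D3 D4 !subr0 (ltr0_norm s0) (ltr0_norm s1) (gtr0_norm t1') (gtr0_norm t0).
have [h1 [i hi]] := bd _ _ ps b1; have [h2 [j hj]] := bd _ _ pt b2.
have ryx : max_ratio a b y x = (1 - s) / - s.
  apply: (ratio_eq i0 (i := i)) => //; first exact: open_closed.
    move=> l; rewrite mulrAC ler_pdivlMr ?oppr_gt0 //.
    by have := h1 l; lra.
  have -> : slack a b i y = (1 - s) / - s * slack a b i x +
      ((1 - s) * slack a b i x + s * slack a b i y) / s.
    by field; rewrite ltr0_neq0.
  by rewrite hi mul0r addr0.
have rxy : max_ratio a b x y = t / (t - 1).
  apply: (ratio_eq i0 (i := j)) => //; first exact: open_closed.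
    move=> l; rewrite mulrAC ler_pdivlMr //.
    by have := h2 l; lra.
  have -> : slack a b j x = t / (t - 1) * slack a b j y -
      ((1 - t) * slack a b j x + t * slack a b j y) / (t - 1).
    by field; rewrite gt_eqF.
  by rewrite hj mul0r subr0.
rewrite /xratio ryx rxy; congr ln; field.
by rewrite u0 (gt_eqF t1') (ltr0_neq0 s0).
Qed.

End PolytopeTopology.

(** * Barycentric coordinates *)

Section AffineBasis.
Variables (R : realType) (n : nat).
Implicit Types x y : 'rV[R]_n.

Lemma row_mx1_mul x (c : 'cV[R]_(n + 1)) :
  (row_mx x 1 *m c) 0 0 = dotp (usubmx c)^T x + c (rshift n 0) 0.
Proof.
rewrite -{1}(vsubmxK c) mul_row_col mul1mx mxE [dsubmx _ _ _]mxE mxE.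
by congr (_ + _); apply: eq_bigr => i _; rewrite !mxE mulrC.
Qed.

Lemma annihilated_rows m (A : 'M[R]_(m, n + 1)) : (\rank A < n + 1)%N ->
  exists c : 'cV[R]_(n + 1), c != 0 /\ A *m c = 0.
Proof.
move=> rA; have : cokermx A != 0.
  by rewrite -mxrank_eq0 mxrank_coker subn_eq0 -ltnNge.
move=> cA; have [j cj] : exists j, col j (cokermx A) != 0.
  apply: contrapT => h; case/eqP: cA; apply/matrixP => i j; rewrite [RHS]mxE.
  apply: contrapT => hij; apply: h; exists j; apply/eqP => /colP/(_ i).
  by rewrite mxE [RHS]mxE.
exists (col j (cokermx A)); split=> //.
by rewrite colE mulmxA mulmx_coker mul0mx.
Qed.

(** Greedy choice: fewer than [n + 1] rows are annihilated by some nonzero affine functional [c],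
    and a point of [P] off its zero set gives a further independent row. *)
Lemma affine_basis (P : 'rV[R]_n -> Prop) :
  (forall c : 'cV[R]_(n + 1), c != 0 ->
    exists v, P v /\ (row_mx v 1 *m c) 0 0 != 0) ->
  exists v : 'I_(n + 1) -> 'rV[R]_n, (forall i, P (v i)) /\
    (\matrix_i row_mx (v i) 1 : 'M[R]_(n + 1)) \in unitmx.
Proof.
move=> hP.
suff : forall m, (m <= n + 1)%N -> exists A : 'M[R]_(m, n + 1), row_free A /\
    forall i, exists v, P v /\ row i A = row_mx v 1.
  move=> /(_ _ (leqnn _))[A [Af /choice[v hv]]]; exists v.
  split=> [i|]; first exact: (hv i).1.
  rewrite -row_free_unit; congr row_free: Af.
  by apply/row_matrixP => i; rewrite rowK (hv i).2.
elim=> [_|m IH mn].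
  exists 0; split=> [|[]//]; by rewrite /row_free mxrank0.
have [A [Af Av]] := IH (ltnW mn).
have [|c [c0 Ac]] := @annihilated_rows _ A; first by rewrite (eqP Af).
have [w [Pw wc]] := hP c c0.
rewrite -(addn1 m); exists (col_mx A (row_mx w 1)); split.
  apply: inj_row_free => u; rewrite -[u]hsubmxK mul_row_col => e.
  have u2 : rsubmx u = 0.
    have := congr1 (mulmx^~ c) e; rewrite mulmxDl -!mulmxA Ac mulmx0 add0r mul0mx.
    rewrite [row_mx w 1 *m c]mx11_scalar mul_mx_scalar => /eqP.
    by rewrite scaler_eq0 (negPf wc) => /eqP.
  move: e; rewrite u2 mul0mx addr0 => e; rewrite (_ : lsubmx u = 0) ?row_mx0 //.
  by apply: (row_free_inj Af); rewrite e mul0mx.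
move=> i; have [j ->|j ->] := split_ordP i; first by rewrite rowKu.
by exists w; split=> //; rewrite rowKd ord1 row_id.
Qed.

Variable v : 'I_(n + 1) -> 'rV[R]_n.
(** Rows are homogeneous coordinates, so invertibility means affine independence of the points. *)
Definition vertex_mx : 'M[R]_(n + 1) := \matrix_i row_mx (v i) 1.
Hypothesis Au : vertex_mx \in unitmx.
Definition bary x j := (row_mx x 1 *m invmx vertex_mx) 0 j.

Lemma bary_affine j : exists c d, forall x, bary x j = dotp c x + d.
Proof.
exists (usubmx (col j (invmx vertex_mx)))^T, (col j (invmx vertex_mx) (rshift n 0) 0).
by move=> x; rewrite -row_mx1_mul colE mulmxA -colE mxE.
Qed.

Lemma bary_mul x : row_mx x 1 = (\row_j bary x j) *m vertex_mx.
Proof.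
have -> : \row_j bary x j = row_mx x 1 *m invmx vertex_mx.
  by apply/rowP => j; rewrite mxE.
by rewrite mulmxKV.
Qed.

Lemma bary_sum1 x : \sum_j bary x j = 1.
Proof.
have /rowP/(_ (rshift n 0)) := bary_mul x.
rewrite row_mxEr mxE eqxx mulr1n => ->; rewrite mxE.
by apply: eq_bigr => j _; rewrite mxE /vertex_mx mxE row_mxEr mxE eqxx mulr1.
Qed.

Lemma bary_comb x : x = \sum_j bary x j *: v j.
Proof.
apply/rowP => i; have /rowP/(_ (lshift 1 i)) := bary_mul x.
rewrite row_mxEl => ->; rewrite mxE summxE.
by apply: eq_bigr => j _; rewrite mxE /vertex_mx mxE row_mxEl mxE.
Qed.

Lemma bary_basis i j : bary (v i) j = (i == j)%:R.
Proof.
rewrite /bary.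
have -> : row_mx (v i) 1 = row i vertex_mx by rewrite rowK.
by rewrite -row_mul mulmxV // !mxE.
Qed.

Lemma bary_chord x y t j : 1 + t != 0 ->
  (1 + t) * bary (chord x y t) j = bary x j + t * bary y j.
Proof.
have [c [d e]] := bary_affine j; move=> t1.
by rewrite !e /chord dotpZr dotpDr dotpZr; field.
Qed.

Lemma bary_sumE (I : Type) (s : seq I) (f : I -> R) (u : I -> 'rV[R]_n) j :
  \sum_(i <- s) f i = 1 ->
  bary (\sum_(i <- s) f i *: u i) j = \sum_(i <- s) f i * bary (u i) j.
Proof.
have [c [d e]] := bary_affine j; move=> f1; rewrite e dotp_sumr.
rewrite -[d]mul1r -{1}f1 mulr_suml -big_split.
by apply: eq_bigr => i _; rewrite dotpZr e mulrDr.
Qed.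

End AffineBasis.

Lemma polytope_affine_basis (R : realType) (n k : nat) (a : 'I_k -> 'rV[R]_n)
    (b : 'I_k -> R) (M : R) :
  open_polytope a b !=set0 ->
  (forall x, open_polytope a b x -> Defs.edist x 0 <= M) ->
  exists v : 'I_(n + 1) -> 'rV[R]_n,
    (forall i, vertex a b (v i)) /\ vertex_mx v \in unitmx.
Proof.
move=> X0 XM; apply: affine_basis => c c0.
pose u := (usubmx c)^T; pose d := c (rshift n 0) 0.
suff [x xc xd] : exists2 x, closed_polytope a b x & dotp u x + d != 0.
  have [v [vv vd]] := vertex_off_hyperplane X0 XM xc xd.
  by exists v; split=> //; rewrite row_mx1_mul.
have [x0 x0X] := X0.
have [x0d|x0d] := eqVneq (dotp u x0 + d) 0; last first.
  by exists x0; first exact: open_closed.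
(* If the linear part vanished, the value 0 at [x0] would kill the constant part too. Hence a small
   step along [u] leaves the hyperplane. *)
have u0 : u != 0.
  apply: contra c0 => /eqP u0; move: x0d; rewrite u0 dotpC dotp0r add0r => d0.
  apply/eqP; rewrite -(vsubmxK c) -(trmxK (usubmx c)) -/u u0 trmx0.
  have -> : dsubmx c = 0 by apply/colP => i; rewrite !mxE !ord1.
  exact: col_mx0.
have [e [e0 _ he]] := nbhs_line (x0 + u)
  (open_nbhs_nbhs (conj (@open_open_polytope _ _ _ a b) x0X)).
exists (x0 + e *: u).
  have := he e (ltW e0) (lexx _); have -> : x0 + u - x0 = u by rewrite addrC addKr.
  exact: open_closed.
have := mulr_gt0 e0 (dotp_gt0 u0) => eu.
by rewrite !dotpE; apply: lt0r_neq0; lra.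
Qed.

(** * Isometries along chords through vertices *)

Lemma vertex_active (R : realType) n k (a : 'I_k -> 'rV[R]_n) b v :
  (0 < n)%N -> vertex a b v -> exists i, slack a b i v = 0.
Proof.
move=> n0 [vc vx]; apply: contrapT => h.
have /rowP/(_ (Ordinal n0))/eqP : const_mx 1 = 0 :> 'rV[R]_n.
  by apply: vx => i vi; case: h; exists i.
by rewrite !mxE oner_eq0.
Qed.

Section Isometry.
Variables (R : realType) (n k l : nat).
Variables (a : 'I_k -> 'rV[R]_n) (b : 'I_k -> R).
Variables (a' : 'I_l -> 'rV[R]_n) (b' : 'I_l -> R).
Variables (g G : 'rV[R]_n -> 'rV[R]_n) (i0 : 'I_k) (j0 : 'I_l).
Local Notation X := (open_polytope a b).
Local Notation cX := (closed_polytope a b).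
Local Notation Y := (open_polytope a' b').
Local Notation cY := (closed_polytope a' b').
Hypotheses (n0 : (0 < n)%N) (pta : positively_spanning a) (pta' : positively_spanning a').
Hypothesis gX : forall x, X x -> Y (g x).
Hypothesis gY : forall y, Y y -> exists2 x, X x & g x = y.
Hypothesis g_iso : forall x y, X x -> X y ->
  xratio a' b' (g x) (g y) = xratio a b x y.
Hypothesis Gc : {within cX, continuous G}.
Hypothesis GX : forall x, cX x -> cY (G x).
Hypothesis Gg : forall x, X x -> G x = g x.

Lemma open_segment (m : nat) (c : 'I_m -> 'rV[R]_n) d p q r :
  open_polytope c d p -> open_polytope c d q -> 0 <= r -> r <= 1 ->
  open_polytope c d (p + r *: (q - p)).
Proof.
move=> po qo; rewrite le_eqVlt => /orP[/eqP<-|r0] r1.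
  by rewrite scale0r addr0.
by apply: open_lerp => //; apply: open_closed.
Qed.

(** * The isometry on chords ending at a fixed vertex *)

Section AtVertex.
Variable v : 'rV[R]_n.
Hypothesis vv : vertex a b v.

Let vc : cX v := proj1 vv.

(** On the image segment take the point at the required distance from [g x]. Its preimage [z] lies
    on a geodesic from [x] to [chord x v T], hence on the chord by [vertex_geodesic], and the
    distance identifies its parameter as [t]. *)
Lemma isometry_chord_between x t T : X x -> 0 <= t -> t <= T ->
  exists r, [/\ 0 <= r, r <= 1 &
    g (chord x v t) = g x + r *: (g (chord x v T) - g x)].
Proof.
move=> xX t0 tT; have [i vi] := vertex_active n0 vv.
have T0 : 0 <= T by lra.
have xT := chord_open xX vc T0.
have k1 := boundary_ratio_gt1 pta vi xX.
have [r [r0 r1 e]] := @xratio_ivt _ _ _ _ _ j0 pta' (g x) (g (chord x v T))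
  (1 + t * max_ratio a b v x) (gX xX) (gX xT)
  ltac:(nra) ltac:(rewrite g_iso // (xratio_chord i0 vc vi) //; nra).
exists r; split=> //.
have [z zX gz] := gY (open_segment (gX xX) (gX xT) r0 r1).
have := xratio_between j0 pta' (gX xX) (gX xT) r0 r1.
rewrite -gz in e *; rewrite !g_iso // => btw.
have zE := vertex_geodesic i0 vv xX zX T0 btw.
congr g; rewrite zE; congr chord.
have r1z := ratio_ge1 i0 pta x zX.
move: e; rewrite g_iso // {1}zE (xratio_chord i0 vc vi) //; last lra.
by move=> /addrI/esym; apply: mulIf; rewrite gt_eqF //; lra.
Qed.

(** The image lies between [g x] and the image of a chord point beyond it; as that point tends to
    [v], its image tends to [G v]. *)
Lemma isometry_chord_halfspace x t u c : X x -> 0 <= t ->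
  dotp u (g x) <= c -> dotp u (G v) <= c -> dotp u (g (chord x v t)) <= c.
Proof.
move=> xX t0 ux uv; apply/ler_addgt0Pr => e e0.
have [d [d0 d1 hd]] := within_continuous_line u Gc (q := x)
  (fun s s0 s1 => closed_lerp vc (open_closed xX) s0 s1) e0.
pose s := Num.min d (1 + t)^-1.
have t1 : 0 < 1 + t by lra.
have s0 : 0 < s by rewrite lt_min d0 invr_gt0.
(* The point at distance fraction [s] from [v] has chord parameter [s^-1 - 1]; this puts it beyond
   parameter [t]. *)
have st : t <= s^-1 - 1.
  have : s <= (1 + t)^-1 by rewrite ge_min lexx orbT.
  by rewrite -[leLHS]invrK lef_pV2 ?posrE ?invr_gt0 //; lra.
have := hd s (ltW s0); rewrite ge_min lexx => /(_ isT).
have e1 : 1 + (s^-1 - 1) = s^-1 by ring.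
have -> : v + s *: (x - v) = chord x v (s^-1 - 1).
  by rewrite chord_lerp e1 ?invrK // invr_eq0 gt_eqF.
rewrite Gg; last by apply: chord_open => //; lra.
have [r [r0 r1 ->]] := isometry_chord_between xX t0 st.
rewrite !dotpE => /ltr_distlDr h.
move: (dotp u (g (chord x v _))) h => A h.
have hA : A <= c + e by lra.
have : (1 - r) * dotp u (g x) <= (1 - r) * (c + e).
  by rewrite ler_wpM2l ?subr_ge0 //; lra.
have : r * A <= r * (c + e) by rewrite ler_wpM2l.
lra.
Qed.

Lemma isometry_chord_segment x t : X x -> 0 <= t ->
  exists r, [/\ 0 <= r, r <= 1 & g (chord x v t) = g x + r *: (G v - g x)].
Proof.
move=> xX t0; apply: in_segment_halfspaces => u c.
exact: isometry_chord_halfspace.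
Qed.

(* Along a chord ending at v the distances to a fixed point are unbounded, whereas they
   would stay bounded on a segment ending inside Y. *)
Lemma vertex_image_boundary x : X x -> exists j, slack a' b' j (G v) = 0.
Proof.
move=> xX; apply: boundary_active; first exact: GX.
move=> vY; have [i vi] := vertex_active n0 vv.
(* With this [t] the distance from [g x] to the image exceeds the length of the segment from [g x]
   to [G v] that contains it. *)
pose t := xratio a' b' (g x) (G v).
have t1 : 1 <= t := xratio_ge1 j0 pta' (gX xX) vY.
have t0 : 0 <= t by lra.
have [r [r0 r1 e]] := isometry_chord_segment xX t0.
have := xratio_between j0 pta' (gX xX) vY r0 r1.
rewrite -e g_iso //; last exact: chord_open.
rewrite (xratio_chord i0 vc vi) // -/t.
have := xratio_ge1 j0 pta' (gX (chord_open xX vc t0)) vY.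
have := boundary_ratio_gt1 pta vi xX.
move: (max_ratio _ _ _ _) (xratio _ _ _ _) => A B A1 B1 h.
have : 1 + t * A <= (1 + t * A) * B by rewrite ler_peMr //; nra.
nra.
Qed.

(** Quotient of the slopes in [xratio_chord] for source and target: the factor by which [g]
    multiplies chord parameters. *)
Definition scale_factor x := max_ratio a b v x / max_ratio a' b' (G v) (g x).

Lemma scale_factor_gt0 x : X x -> 0 < scale_factor x.
Proof.
move=> xX; have [i vi] := vertex_active n0 vv.
have [j vj] := vertex_image_boundary xX.
have := boundary_ratio_gt1 pta vi xX.
have := boundary_ratio_gt1 pta' vj (gX xX).
by move=> h1 h2; rewrite divr_gt0 //; lra.
Qed.

Lemma isometry_chord_forward x t : X x -> 0 <= t ->
  g (chord x v t) = chord (g x) (G v) (t * scale_factor x).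
Proof.
move=> xX t0; have [i vi] := vertex_active n0 vv.
have [j vj] := vertex_image_boundary xX.
have [r [r0 r1 e]] := isometry_chord_segment xX t0.
have xt := chord_open xX vc t0.
have r1' : r < 1.
  rewrite lt_neqAle r1 andbT; apply/eqP => rE.
  have := gX xt j; rewrite e rE scale1r addrC subrK vj ltxx //.
have r1n : 1 - r != 0 by rewrite gt_eqF // subr_gt0.
rewrite lerp_chord // in e.
rewrite e; congr chord.
have := g_iso xX xt; rewrite e (xratio_chord i0 vc vi) //.
rewrite (xratio_chord j0 (GX vc) vj) //; last first.
- by rewrite divr_ge0 // subr_ge0.
- exact: gX.
have := boundary_ratio_gt1 pta' vj (gX xX).
rewrite /scale_factor; move: (max_ratio a' _ _ _) => A A1 /addrI h.
by rewrite mulrA -h mulfK // gt_eqF //; lra.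
Qed.

(** For negative [t] the point [x] is reached forward from [chord x v t]. Inverting that relation
    gives the image, and [ratio_chord_shift] on both sides converts the scale factor at the new
    point into the one at [x]. *)
Lemma isometry_chord x t : X x -> 0 < 1 + t -> X (chord x v t) ->
  0 < 1 + t * scale_factor x /\
  g (chord x v t) = chord (g x) (G v) (t * scale_factor x).
Proof.
move=> xX t1 yX; have [t0|t0] := leP 0 t.
  split; last exact: isometry_chord_forward.
  by rewrite ltr_pwDl // mulr_ge0 // ltW // scale_factor_gt0.
have t1' := lt0r_neq0 t1.
pose s := - t / (1 + t).
have s0 : 0 <= s by rewrite divr_ge0 ?(ltW t1) // oppr_ge0 ltW.
have s1 : 1 + s = (1 + t)^-1 by rewrite /s; field.
have xE : x = chord (chord x v t) v s.
  rewrite /chord s1 invrK; apply/rowP => i; rewrite !mxE /s; field.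
  exact: t1'.
have f0 := scale_factor_gt0 yX.
have := isometry_chord_forward yX s0; rewrite -xE.
set f := scale_factor (chord x v t) in f0 *.
set y := g (chord x v t); move=> gx.
have sf : 0 < 1 + s * f.
  have : 0 <= s * f by rewrite mulr_ge0 // ltW.
  lra.
have sf' := lt0r_neq0 sf.
pose T := - (s * f) / (1 + s * f).
have T1 : 1 + T = (1 + s * f)^-1 by rewrite /T; field.
have yE : y = chord (g x) (G v) T.
  rewrite gx /chord T1 invrK; apply/rowP => i; rewrite !mxE /T; field.
  exact: sf'.
suff TE : T = t * scale_factor x.
  by rewrite -TE yE; split=> //; rewrite T1 invr_gt0.
have T1p : 0 < 1 + T by rewrite T1 invr_gt0.
have yY : Y (chord (g x) (G v) T) by rewrite -yE; apply: gX.
have [d1 e1] := ratio_chord_shift i0 vc xX t1 yX.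
have [d2 e2] := ratio_chord_shift j0 (GX vc) (gX xX) T1p yY.
have fE : f = (1 + t) * max_ratio a b v x / (1 + t * max_ratio a b v x) /
  ((1 + T) * max_ratio a' b' (G v) (g x) / (1 + T * max_ratio a' b' (G v) (g x))).
  by rewrite -e1 -e2 -yE.
have [i vi] := vertex_active n0 vv.
have [j vj] := vertex_image_boundary xX.
have h1 := boundary_ratio_gt1 pta vi xX.
have h2 := boundary_ratio_gt1 pta' vj (gX xX).
have TsE : - (s * f) = T / (1 + T).
  by rewrite T1 invrK /T; field.
move: TsE; rewrite fE /s /scale_factor.
move: (max_ratio a b _ _) (max_ratio a' _ _ _) h1 h2 d1 d2 => A B A1 B1 d1 d2 h.
have B0 : B != 0 by apply: lt0r_neq0; lra.
have h3 : t * A * (1 + T * B) = T * B * (1 + t * A).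
  have -> : t * A * (1 + T * B) = - (- t / (1 + t) * ((1 + t) * A / (1 + t * A) /
    ((1 + T) * B / (1 + T * B)))) * (1 + T) * B * (1 + t * A).
    by field; rewrite t1' B0 !lt0r_neq0.
  rewrite h; field.
  by rewrite lt0r_neq0.
have h4 : t * A = T * B by lra.
by rewrite mulrA h4 mulfK.
Qed.

(** Since [u] may lie on the boundary, it is first pushed to an open point [w], where the chord
    bound applies; continuity of [G] at [u] and at the dividing point [z] absorbs the error. *)
Lemma extension_halfspace u x0 r c m : cX u -> X x0 -> 0 <= r -> r <= 1 ->
  dotp c (G v) <= m -> dotp c (G u) <= m ->
  dotp c (G (v + r *: (u - v))) <= m.
Proof.
move=> uX x0X; rewrite le_eqVlt => /orP[/eqP<-|r0] r1 vm um.
  by rewrite scale0r addr0.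
have x0c := open_closed x0X.
set z := v + r *: (u - v).
have zX : cX z by apply: closed_lerp => //; apply: ltW.
have z1X : cX (v + r *: (x0 - v)) by apply: closed_lerp => //; apply: ltW.
apply/ler_addgt0Pr => e e0.
have e2 : 0 < e / 2 by lra.
have [d [d0 d1 hd]] := within_continuous_line c Gc
  (fun s s0 s1 => closed_lerp uX x0c s0 s1) e2.
have [d' [d0' d1' hd']] := within_continuous_line c Gc
  (fun s s0 s1 => closed_lerp zX z1X s0 s1) e2.
pose s := Num.min d d'.
have s0 : 0 < s by rewrite lt_min d0.
have sd : s <= d by rewrite ge_min lexx.
have sd' : s <= d' by rewrite ge_min lexx orbT.
have s1 : s <= 1 by lra.
have wX : X (u + s *: (x0 - u)) by apply: open_lerp.
set w := u + s *: (x0 - u) in wX.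
have zw : z + s *: (v + r *: (x0 - v) - z) = chord w v (r^-1 - 1).
  have er : 1 + (r^-1 - 1) = r^-1 by ring.
  rewrite chord_lerp er ?invr_eq0 ?gt_eqF // invrK /z /w.
  by apply/rowP => i; rewrite !mxE; ring.
have t0 : 0 <= r^-1 - 1 by rewrite subr_ge0 invf_ge1.
have := hd s (ltW s0) sd; rewrite -/w (Gg wX) => /ltr_distlDr h1.
have := hd' s (ltW s0) sd'; rewrite zw Gg; last exact: chord_open.
rewrite distrC => /ltr_distlDr h2.
have := @isometry_chord_halfspace w (r^-1 - 1) c (m + e / 2) wX t0 _ _.
move=> /(_ ltac:(lra) ltac:(lra)); lra.
Qed.

End AtVertex.

Lemma slack_sum (m : nat) (c : 'I_m -> 'rV[R]_n) d i (I : eqType) (s : seq I) (f : I -> R)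
    (v : I -> 'rV[R]_n) : \sum_(j <- s) f j = 1 ->
  slack c d i (\sum_(j <- s) f j *: v j) = \sum_(j <- s) f j * slack c d i (v j).
Proof.
move=> f1; rewrite /slack dotp_sumr -[d i]mul1r -{1}f1 mulr_suml -sumrB.
by apply: eq_bigr => j _; rewrite dotpZr mulrBr mul1r.
Qed.

(** Half-space form of the fact that [G] maps hulls of vertices into hulls of their images, by
    splitting off one vertex at a time. Testing only nonzero weights makes it apply to faces. *)
Lemma extension_conv (I : eqType) (s : seq I) (f : I -> R) (v : I -> 'rV[R]_n) x0 c m :
  X x0 -> (forall i, vertex a b (v i)) -> (forall i, 0 <= f i) ->
  \sum_(i <- s) f i = 1 ->
  (forall i, f i != 0 -> dotp c (G (v i)) <= m) ->
  dotp c (G (\sum_(i <- s) f i *: v i)) <= m.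
Proof.
move=> x0X vv; elim: s f => [f _|i s IH f f0].
  by rewrite big_nil => /esym/eqP; rewrite oner_eq0.
rewrite !big_cons => f1 fm.
have [fi|fi] := eqVneq (f i) 0.
  by rewrite fi scale0r add0r; apply: IH; rewrite // -f1 fi add0r.
have [fs|fs] := eqVneq (\sum_(j <- s) f j) 0.
  have -> : \sum_(j <- s) f j *: v j = 0.
    rewrite big_seq big1 // => j js.
    move: fs => /eqP; rewrite psumr_eq0 // => /allP/(_ j js)/eqP->.
    by rewrite scale0r.
  move: f1; rewrite fs !addr0 => ->; rewrite scale1r.
  exact: fm.
set F := \sum_(j <- s) f j in f1 fs.
have F0 : 0 < F by rewrite lt_neqAle eq_sym fs sumr_ge0.
pose u := \sum_(j <- s) (f j / F) *: v j.
have u1 : \sum_(j <- s) f j / F = 1 by rewrite -mulr_suml divff.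
have f0' j : 0 <= f j / F by rewrite divr_ge0 // ltW.
have -> : f i *: v i + \sum_(j <- s) f j *: v j = v i + F *: (u - v i).
  have -> : \sum_(j <- s) f j *: v j = F *: u.
    rewrite scaler_sumr; apply: eq_bigr => j _.
    by rewrite scalerA mulrC divfK.
  have -> : f i = 1 - F by rewrite -f1; ring.
  by apply/rowP => j; rewrite !mxE; ring.
apply: (extension_halfspace (vv i) _ x0X (ltW F0)).
- move=> j; rewrite slack_sum //.
  by apply: sumr_ge0 => q _; rewrite mulr_ge0 //; apply: (vv q).1.
- by rewrite -f1 lerDr.
- exact: fm.
- apply: IH => // j fj; apply: fm; apply: contra_neq fj => ->.
  by rewrite mul0r.
Qed.

(** * Isometries in barycentric coordinates *)

Section Simplex.
Variables (v : 'I_(n + 1) -> 'rV[R]_n) (H : 'rV[R]_n -> 'rV[R]_n).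
Hypothesis vv : forall i, vertex a b (v i).
Hypothesis Au : vertex_mx v \in unitmx.
Hypothesis X0 : X !=set0.
Hypothesis Hc : {within cY, continuous H}.
Hypothesis Hg : forall x, X x -> H (g x) = x.
Local Notation al := (bary v).
Local Notation w := (fun i => G (v i)).

Let vc i : cX (v i) := proj1 (vv i).

(** Vertices are added one by one: when total mass [1 + F] has been reached, adding weight [f i] is
    a chord of parameter [f i / (1 + F)]. *)
Lemma chord_reach (Z : set 'rV[R]_n) (f : 'I_(n + 1) -> R) x :
  (forall y i t, 0 <= t -> Z y -> Z (chord y (v i) t)) ->
  (forall i, 0 <= f i) -> Z x ->
  Z ((1 + \sum_i f i)^-1 *: (x + \sum_i f i *: v i)).
Proof.
move=> Zc f0 Zx; elim: (index_enum _) => [|i s IH].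
  by rewrite !big_nil !addr0 invr1 scale1r.
rewrite !big_cons; set F := \sum_(j <- s) f j in IH *.
set S := \sum_(j <- s) f j *: v j in IH *.
have F0 : 0 <= F by apply: sumr_ge0.
have fi := f0 i.
have d1 : 1 + F != 0 by apply: lt0r_neq0; lra.
have d2 : 1 + (f i + F) != 0 by apply: lt0r_neq0; lra.
have := Zc _ i (f i / (1 + F)) (divr_ge0 (f0 i) (addr_ge0 ler01 F0)) IH.
congr Z; rewrite /chord; apply/rowP => j; rewrite !mxE; field.
by rewrite d1 d2.
Qed.

Lemma interior_point : exists x, X x /\ forall j, 0 < al x j.
Proof.
have [x0 x0X] := X0.
(* Moving towards every vertex with weight [T] adds [T] to each unnormalised coordinate, enough to
   make all of them positive. *)
pose T := 1 + \sum_j `|al x0 j|.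
have T1 j : 0 < al x0 j + T.
  rewrite /T (bigD1 j) //=.
  have : 0 <= \sum_(i | i != j) `|al x0 i| by apply: sumr_ge0.
  have := ler_norm (- al x0 j); rewrite normrN; lra.
have T0 : 0 <= T by rewrite addr_ge0 // sumr_ge0.
clearbody T.
have S0 : 0 < 1 + \sum_(j < n + 1) T by rewrite ltr_pwDl // sumr_ge0.
exists ((1 + \sum_(j < n + 1) T)^-1 *: (x0 + \sum_(j < n + 1) T *: v j)); split.
  apply: (chord_reach (Z := X)) => // y i t t0 yX.
  exact: chord_open.
move=> j; have -> : x0 + \sum_(j < n + 1) T *: v j =
    \sum_(i < n + 1) (al x0 i + T) *: v i.
  rewrite {1}(bary_comb Au x0) -big_split; apply: eq_bigr => i _.
  by rewrite scalerDl.
rewrite scaler_sumr; under eq_bigr do rewrite scalerA.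
rewrite bary_sumE; last first.
  by rewrite -mulr_sumr big_split /= bary_sum1 // mulVf // gt_eqF.
rewrite (bigD1 j) //= [X in _ + X]big1 ?addr0 => [|i ij].
  by rewrite bary_basis // eqxx mulr1 mulr_gt0 // invr_gt0.
by rewrite bary_basis // (negPf ij) mulr0.
Qed.

Lemma nbhs_interior x : (forall j, 0 < al x j) -> nbhs x [set y | forall j, 0 < al y j].
Proof.
move=> xp.
apply: (@filter_forall _ _ (fun j y => 0 < al y j) (nbhs x) (@nbhs_filter _ x)) => j.
have [c [d e]] := bary_affine v j.
have cc : continuous (fun y => al y j).
  have -> : (fun y => al y j) = (fun y => dotp c y + d) by apply/funext => y.
  move=> y; apply: (continuousD (f := dotp c) (g := cst d)).
    exact: continuous_dotpl.
  exact: cst_continuous.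
exact: (cvgr_gt _ (cc x) _ (xp j)).
Qed.

Lemma extension_sign x c d : X x -> (forall j, 0 <= al x j) ->
  (forall i, dotp c (w i) = d) -> dotp c (g x) = d.
Proof.
move=> xX xp h; rewrite -Gg // (bary_comb Au x); apply/le_anti/andP; split.
  apply: (extension_conv xX vv xp (bary_sum1 Au x)) => i _.
  by rewrite h.
have := extension_conv (c := - c) (m := - d) xX vv xp (bary_sum1 Au x).
rewrite !dotpNl lerN2; apply=> i _.
by rewrite dotpNl h.
Qed.

(* If the images of the vertices lay in a hyperplane, so would the image of the simplex,
   which is open because the inverse of g is continuous. *)
Lemma image_vertex_unit : vertex_mx w \in unitmx.
Proof.
rewrite -row_free_unit /row_free; apply: contrapT => /negP r.
have [|c [c0 Bc]] := @annihilated_rows _ _ _ (vertex_mx w).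
  by rewrite ltn_neqAle r rank_leq_row.
pose u := (usubmx c)^T; pose d := c (rshift n 0) 0.
have wu i : dotp u (w i) = - d.
  apply/eqP; rewrite -subr_eq0 opprK -row_mx1_mul.
  have -> : row_mx (w i) 1 = row i (vertex_mx w) by rewrite rowK.
  by rewrite -row_mul Bc !mxE.
have [x [xX xp]] := interior_point.
have gu y : X y -> (forall j, 0 < al y j) -> dotp u (g y) = - d.
  by move=> yX yp; apply: extension_sign => // j; apply/ltW/yp.
have u0 : u != 0.
  apply: contra c0 => /eqP u0; have := gu x xX xp.
  rewrite u0 dotpC dotp0r => /esym/eqP; rewrite oppr_eq0 => /eqP d0.
  apply/eqP; rewrite -(vsubmxK c) -(trmxK (usubmx c)) -/u u0 trmx0.
  have -> : dsubmx c = 0 by apply/colP => i; rewrite !mxE !ord1.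
  exact: col_mx0.
have yY := gX xX; set y := g x in yY.
have [e [e0 e1 he]] := nbhs_line (y + u)
  (open_nbhs_nbhs (conj (@open_open_polytope _ _ _ a' b') yY)).
pose q := y + e *: u.
have yu : y + u - y = u by rewrite addrC addKr.
have qY : Y q by have := he e (ltW e0) (lexx _); rewrite yu.
have xpH : nbhs (H y) [set z | forall j, 0 < al z j].
  by rewrite Hg //; apply: nbhs_interior.
have [s [s0 s1 hs]] := within_continuous_nbhs_line Hc
  (fun s s0 s1 => closed_lerp (open_closed yY) (open_closed qY) s0 s1) xpH.
have zY := open_segment yY qY (ltW s0) s1.
have zp := hs s (ltW s0) (lexx _).
have [z zX gz] := gY zY; rewrite -gz Hg //= in zp.
have := gu z zX zp; rewrite gz -(gu x xX xp) -/y /q !dotpE.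
have := mulr_gt0 (mulr_gt0 s0 e0) (dotp_gt0 u0); lra.
Qed.

Local Notation be := (bary w).
Local Notation Bu := image_vertex_unit.

(* The chord from x away from v j leaves the simplex through the face opposite to v j,
   which is mapped to the face opposite to w j. *)
Lemma scale_factor_bary x j : X x -> (forall i, 0 < al x i) ->
  scale_factor (v j) x * al x j = be (g x) j.
Proof.
move=> xX xp; set f := scale_factor _ _; set A := al x j.
have A0 : 0 < A := xp j.
have f0 : 0 < f := scale_factor_gt0 (vv j) xX.
have sumA : \sum_(i | i != j) al x i = 1 - A.
  by rewrite -(bary_sum1 Au x) [in RHS](bigD1 j) //= addrC addrK.
have A1 : 0 < 1 - A.
  (* Positive dimension provides a second vertex, whose positive coordinate keeps [A] below 1. *)
  have [i ij] : exists i, i != j.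
    have l0 : (0 < n + 1)%N by rewrite addn1.
    have l1 : (1 < n + 1)%N by rewrite addn1 ltnS.
    have [->|j1] := eqVneq j (Ordinal l0); first by exists (Ordinal l1).
    by exists (Ordinal l0); rewrite eq_sym.
  rewrite -sumA (bigD1 i) //= ltr_pwDl //.
  by apply: sumr_ge0 => q _; apply: ltW.
have A1' := lt0r_neq0 A1.
(* Weights of the point [u] where the line from [v j] through [x] meets the opposite face. *)
pose h i := if i == j then 0 else al x i / (1 - A).
have h0 i : 0 <= h i.
  by rewrite /h; case: ifP => // _; rewrite divr_ge0 // ltW.
have h1 : \sum_i h i = 1.
  rewrite (bigD1 j) //= {1}/h eqxx add0r.
  under eq_bigr => i ij do rewrite /h (negPf ij).
  by rewrite -mulr_suml sumA divff.
pose u := \sum_i h i *: v i.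
have uc : cX u.
  move=> q; rewrite slack_sum //; apply: sumr_ge0 => i _.
  by rewrite mulr_ge0 //; apply: vc.
have xu : x = u + A *: (v j - u).
  rewrite {1}(bary_comb Au x) (bigD1 j) //= -/A.
  have -> : \sum_(i | i != j) al x i *: v i = (1 - A) *: u.
    rewrite /u [in RHS](bigD1 j) //= {1}/h eqxx scale0r add0r scaler_sumr.
    apply: eq_bigr => i ij.
    by rewrite /h (negPf ij) scalerA mulrC divfK.
  by apply/rowP => i; rewrite !mxE; ring.
have [c [d bE]] := bary_affine w j.
have Gu : dotp c (G u) + d = 0.
  have wd i : h i != 0 -> dotp c (w i) = - d.
    rewrite /h; case: ifPn => [_|ij _]; first by rewrite eqxx.
    by apply/eqP; rewrite -subr_eq0 opprK -bE bary_basis ?Bu // (negPf ij).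
  apply/eqP; rewrite -[d]opprK subr_eq0; apply/eqP/le_anti/andP; split.
    apply: (extension_conv xX vv h0 h1) => i hi.
    by rewrite wd.
  have := extension_conv (c := - c) (m := d) xX vv h0 h1.
  rewrite dotpNl lerNl; apply=> i hi.
  by rewrite dotpNl wd // opprK.
apply/eqP; rewrite -subr_eq0 -normr_le0; apply/ler_addgt0Pr => e e0.
have e2 : 0 < e / 2 by lra.
have [s1 [s10 s11 hs]] := within_continuous_line c Gc
  (fun s s0 s1 => closed_lerp uc (open_closed xX) s0 s1) e2.
(* The second bound controls the error [(t + A) * f] below, the first one the value of [be] near
   [u]. *)
pose s := Num.min s1 (e / 2 / (A * f)).
have Af : 0 < A * f by rewrite mulr_gt0.
have s0 : 0 < s by rewrite lt_min s10 divr_gt0.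
have ss1 : s <= s1 by rewrite ge_min lexx.
have ss2 : s * (A * f) <= e / 2.
  by rewrite -ler_pdivlMr // ge_min lexx orbT.
have {hs} := hs s (ltW s0) ss1.
have sA : 0 < 1 - s * A by nra.
have sA' := lt0r_neq0 sA.
(* Parameter, seen from [x] on the chord to [v j], of a point near [u]. As [s] tends to 0 it tends
   to [- A], while [be (g x) j + t * f] tends to 0. *)
pose t := - (1 - s) * A / (1 - s * A).
have t1 : 1 + t = (1 - A) / (1 - s * A) by rewrite /t; field.
have t1p : 0 < 1 + t by rewrite t1 divr_gt0.
have yX : X (u + s *: (x - u)) by apply: open_lerp => //; lra.
have yE : u + s *: (x - u) = chord x (v j) t.
  rewrite /chord t1 /t; apply/rowP => i; rewrite [in RHS]xu xu !mxE; field.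
  by rewrite A1' sA'.
have t0 : t <= 0.
  by rewrite /t mulNr mulNr oppr_le0 divr_ge0 ?(ltW sA) // mulr_ge0 ?(ltW A0) //; lra.
rewrite Gg // yE; rewrite yE in yX.
have [d1 gE] := isometry_chord (vv j) xX t1p yX; rewrite -/f in d1 gE.
have -> : dotp c (G u) = - d by lra.
rewrite opprK -bE gE => hb.
have := bary_chord w (g x) (w j) j (lt0r_neq0 d1).
rewrite bary_basis ?Bu // eqxx mulr1; set N := bary _ _ _ in hb *; move=> NE.
have tf : t * f <= 0 by rewrite mulr_le0_ge0 // ltW.
have N1 : `|(1 + t * f) * N| < e / 2.
  rewrite normrM gtr0_norm //.
  apply: le_lt_trans hb; rewrite ler_piMl //; lra.
have tA : `|t + A| <= s * A.
  have -> : t + A = s * A * ((1 - A) / (1 - s * A)) by rewrite /t; field.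
  have sA0 : 0 <= s * A by rewrite ltW // mulr_gt0.
  rewrite ger0_norm; last by rewrite mulr_ge0 // divr_ge0 // ltW.
  rewrite ler_piMr // ler_pdivrMr // mul1r; nra.
rewrite NE in N1.
have -> : f * A - be (g x) j = (t + A) * f - (be (g x) j + t * f) by ring.
apply: le_trans (ler_normB _ _) _.
rewrite add0r normrM (gtr0_norm f0).
have : `|t + A| * f <= s * A * f by rewrite ler_wpM2r // ltW.
lra.
Qed.

Lemma bary_chord_basis x m t (j : 'I_(n + 1)) : 1 + t != 0 ->
  (1 + t) * al (chord x (v m) t) j = al x j + t * (m == j)%:R.
Proof. by move=> t1; rewrite bary_chord // bary_basis. Qed.

Lemma bary_image_chord x m t : X x -> 0 <= t ->
  exists r, r != 0 /\ forall j : 'I_(n + 1),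
    r * be (g (chord x (v m) t)) j =
    be (g x) j + t * scale_factor (v m) x * (m == j)%:R.
Proof.
move=> xX t0; have f0 := scale_factor_gt0 (vv m) xX.
have r0 : 1 + t * scale_factor (v m) x != 0.
  by rewrite lt0r_neq0 // ltr_pwDl // mulr_ge0 // ltW.
exists (1 + t * scale_factor (v m) x); split=> // i.
rewrite (isometry_chord_forward (vv m) xX t0) (bary_chord w) //.
by rewrite bary_basis ?Bu.
Qed.

(** * Proportionality of homogeneous coordinates *)

Section Proportionality.
Variable c : 'I_(n + 1) -> R.

(** A two-by-two minor; all of them vanish exactly when the coordinates of [g x] are proportional to
    [c j * al x j]. *)
Definition defect x (i j : 'I_(n + 1)) := be (g x) i * (c j * al x j) - be (g x) j * (c i * al x i).

Lemma defect_chord x m t i j : X x -> 0 <= t -> i != j ->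
  (defect (chord x (v m) t) i j == 0) =
  (defect x i j + t * ((m == i)%:R * (scale_factor (v m) x * (c j * al x j) - be (g x) j * c i)
   + (m == j)%:R * (be (g x) i * c j - scale_factor (v m) x * (c i * al x i))) == 0).
Proof.
move=> xX t0 ij; have [r [r0 rE]] := bary_image_chord m xX t0.
have t1 : 1 + t != 0 by apply: lt0r_neq0; lra.
have -> : defect (chord x (v m) t) i j = (r * (1 + t))^-1 *
  (r * be (g (chord x (v m) t)) i * (c j * ((1 + t) * al (chord x (v m) t) j)) -
   r * be (g (chord x (v m) t)) j * (c i * ((1 + t) * al (chord x (v m) t) i))).
  by rewrite /defect; field; rewrite r0 t1.
rewrite mulf_eq0 invr_eq0 mulf_eq0 (negPf r0) (negPf t1) /=.
rewrite !rE !bary_chord_basis // /defect; congr (_ == 0).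
(* Only coordinate [m] moves and [i != j], so the term quadratic in [t] drops out. *)
have mij : (m == i)%:R * (m == j)%:R = 0 :> R.
  have [->|_] := eqVneq m i; last by rewrite mul0r.
  by rewrite (negPf ij) mulr0.
set F := scale_factor _ _; apply/eqP; rewrite -subr_eq0.
set A := (m == i)%:R in mij *; set B := (m == j)%:R in mij *.
set b1 := be _ i; set b2 := be _ j; set a1 := al x i; set a2 := al x j.
apply/eqP; transitivity (t ^+ 2 * F * (c j - c i) * (A * B)); first by ring.
by rewrite mij mulr0.
Qed.

(** Vanishing minors propagate along chords to the vertices within the simplex, and every point of
    the simplex is reached from [x0] by such chords. *)
Lemma defect_simplex x0 : X x0 -> (forall j, 0 < al x0 j) ->
  (forall i j, defect x0 i j = 0) ->
  forall x, X x -> (forall j, 0 < al x j) -> forall i j, defect x i j = 0.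
Proof.
move=> x0X x0p x0d x xX xp.
pose Z : set 'rV[R]_n := [set y | [/\ X y, forall j, 0 < al y j &
  forall i j, defect y i j = 0]].
suff [] : Z x by [].
(* Large enough for [lam * al x] to dominate [al x0], so the difference gives nonnegative weights
   for [chord_reach]. *)
pose lam := \sum_j al x0 j / al x j.
have lamj j : al x0 j <= lam * al x j.
  rewrite -ler_pdivrMr // /lam (bigD1 j) //= lerDl.
  by apply: sumr_ge0 => i _; rewrite divr_ge0 // ltW.
have f0 j : 0 <= lam * al x j - al x0 j by rewrite subr_ge0.
have Zc y m t : 0 <= t -> Z y -> Z (chord y (v m) t).
  move=> t0 [yX yp yd].
  have t1 : 0 < 1 + t by lra.
  split=> [|j|i j]; first exact: chord_open.
    rewrite -(pmulr_rgt0 _ t1) bary_chord_basis ?lt0r_neq0 //.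
    by rewrite ltr_pwDl // mulr_ge0.
  have [->|ij] := eqVneq i j; first by rewrite /defect subrr.
  apply/eqP; rewrite defect_chord //; apply/eqP; rewrite yd add0r.
  have := yd i j; rewrite /defect.
  have [mi|_] := eqVneq m i; have [mj|_] := eqVneq m j.
  - by move: ij; rewrite -mi mj eqxx.
  - rewrite mul0r addr0 mul1r -mi -(scale_factor_bary m yX yp) => h.
    (* After multiplication by [al y m], the identity [scale_factor_bary] turns the increment into a
       multiple of a defect at [y]. *)
    have := yp m => am; apply: (mulfI (lt0r_neq0 am)); rewrite mulr0.
    rewrite -[RHS](mulr0 t) -h; ring.
  - rewrite mul0r add0r mul1r -mj -(scale_factor_bary m yX yp) => h.
    have := yp m => am; apply: (mulfI (lt0r_neq0 am)); rewrite mulr0.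
    rewrite -[RHS](mulr0 t) -h; ring.
  - by rewrite !mul0r addr0 mulr0.
have := chord_reach Zc f0 (And3 x0X x0p x0d).
rewrite sumrB -mulr_sumr !bary_sum1 // mulr1 addrC subrK.
have lam0 : lam != 0.
  have : 1 <= lam; last by move=> ?; apply: lt0r_neq0; lra.
  rewrite -(bary_sum1 Au x0) -[lam]mulr1 -(bary_sum1 Au x) mulr_sumr.
  exact: ler_sum.
have -> // : lam^-1 *: (x0 + \sum_i (lam * al x i - al x0 i) *: v i) = x.
rewrite {1}(bary_comb Au x0) -big_split /=.
rewrite [RHS](bary_comb Au x) scaler_sumr; apply: eq_bigr => i _.
by rewrite -scalerDl addrC subrK scalerA mulKf.
Qed.

(* Along a chord towards v m the defect is, up to a nonzero factor, affine in the
   parameter, so it vanishes at the starting point once it vanishes at two later points.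
   *)
Lemma defect_open x0 : X x0 -> (forall j, 0 < al x0 j) ->
  (forall i j, defect x0 i j = 0) ->
  forall x, X x -> forall i j, defect x i j = 0.
Proof.
move=> x0X x0p x0d x xX i j.
have [->|ij] := eqVneq i j; first by rewrite /defect subrr.
(* The list [s] holds the indices whose coordinates may fail to be positive; the empty list is the
   simplex case. *)
suff gen (s : seq 'I_(n + 1)) y : X y -> (forall m, m \notin s -> 0 < al y m) ->
    defect y i j = 0.
  by apply: (gen (index_enum _)) => // m; rewrite mem_index_enum.
elim: s y => [y yX yp|m s IH y yX yp].
  by apply: (defect_simplex x0X x0p x0d) => // m; apply: yp.
have van t : 1 + `|al y m| <= t -> defect (chord y (v m) t) i j == 0.
  have := normr_ge0 (al y m) => am ht.
  have t0 : 0 <= t by lra.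
  have t1 : 0 < 1 + t by lra.
  apply/eqP/IH => [|q qs]; first exact: chord_open.
  rewrite -(pmulr_rgt0 _ t1) bary_chord_basis ?lt0r_neq0 //.
  have [<-|mq] := eqVneq m q.
    rewrite mulr1n mulr1.
    by have := ler_norm (- al y m); rewrite normrN; lra.
  by rewrite mulr0n mulr0 addr0 yp // inE negb_or eq_sym mq.
have am := normr_ge0 (al y m).
(* At both parameters coordinate [m] has become positive, so the induction hypothesis applies. They
   differ by 1, which gives [K = 0]. *)
have h1 := van (1 + `|al y m|) (lexx _).
have h2 : defect (chord y (v m) (2 + `|al y m|)) i j == 0 by apply: van; lra.
have p1 : 0 <= 1 + `|al y m| by lra.
have p2 : 0 <= 2 + `|al y m| by lra.
move: h1 h2; rewrite (defect_chord _ yX p1 ij) (defect_chord _ yX p2 ij).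
move: (_%:R * _ + _%:R * _) => K /eqP h1 /eqP h2.
have K0 : K = 0 by lra.
by move: h1; rewrite K0; lra.
Qed.

End Proportionality.

Lemma isometry_projective : exists M : 'M[R]_(n + 1), M \in unitmx /\
  forall x, X x -> exists r, r != 0 /\ row_mx (g x) 1 = r *: (row_mx x 1 *m M).
Proof.
have [x0 [x0X x0p]] := interior_point.
(* Normalised so that all minors vanish at [x0]. *)
pose c j := be (g x0) j / al x0 j.
have c0 j : c j != 0.
  rewrite /c -(scale_factor_bary j x0X x0p) mulfK ?(lt0r_neq0 (x0p j)) //.
  exact/lt0r_neq0/scale_factor_gt0.
have x0d i j : defect c x0 i j = 0.
  by rewrite /defect /c !divfK ?gt_eqF // mulrC subrr.
have xd := defect_open x0X x0p x0d.
exists (invmx (vertex_mx v) *m diag_mx (\row_j c j) *m vertex_mx w); split.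
  rewrite !unitmx_mul unitmx_inv Au image_vertex_unit andbT /=.
  rewrite unitmxE det_diag unitfE prodf_seq_neq0; apply/allP => j _ /=.
  by rewrite mxE.
(* Summing the vanishing minors over [j], with coordinates of [g x] of sum 1, shows that [S] is the
   projective factor. *)
move=> x xX; pose S := \sum_j c j * al x j.
have Sb i : S * be (g x) i = c i * al x i.
  rewrite mulr_suml -[RHS]mul1r -(bary_sum1 Bu (g x)) mulr_suml.
  apply: eq_bigr => j _; apply/eqP; rewrite -subr_eq0 -(xd x xX i j) /defect.
  by apply/eqP; ring.
have S0 : S != 0.
  apply/eqP => S0; have := bary_sum1 Au x; rewrite big1 => [/esym/eqP|j _].
    by rewrite oner_eq0.
  have /esym/eqP := Sb j; rewrite S0 mul0r mulf_eq0 (negPf (c0 j)).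
  by move=> /eqP.
exists S^-1; split; first by rewrite invr_eq0.
rewrite (bary_mul Bu (g x)) !mulmxA scalemxAl; congr (_ *m _).
apply/rowP => j; rewrite mul_mx_diag [LHS]mxE [RHS]mxE [X in _ * X]mxE.
rewrite [X in _ * (_ * X)]mxE -/(bary v x j).
by rewrite -[LHS](mulKf S0) Sb [c j * _]mulrC.
Qed.

End Simplex.
End Isometry.

Theorem theorem6p4 (R : realType) (n : nat) (X Y : set 'rV[R]_n)
  (g : 'rV[R]_n -> 'rV[R]_n) :
  polyhedral_hilbert X -> polyhedral_hilbert Y ->
  g @` X = Y ->
  (forall x y, X x -> X y -> hilbert_dist Y (g x) (g y) = hilbert_dist X x y) ->
  (exists G : 'rV[R]_n -> 'rV[R]_n,
      [/\ {within closure X, continuous G},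
          G @` closure X `<=` closure Y &
          forall x, X x -> G x = g x]) ->
  (exists H : 'rV[R]_n -> 'rV[R]_n,
      [/\ {within closure Y, continuous H},
          H @` closure Y `<=` closure X &
          forall x, X x -> H (g x) = x]) ->
  exists M : 'M[R]_(n + 1),
    M \in unitmx /\
    forall x, X x ->
      exists c : R, c != 0 /\ row_mx (g x) 1 = c *: (row_mx x 1 *m M).
Proof.
move=> [X0 [MX XM] [k [a [b [_ XE]]]]] [Y0 [MY YM] [l [a' [b' [_ YE]]]]].
move=> gXY g_iso [G [Gc GX Gg]] [H [Hc _ Hg]].
(* In dimension 0 there may be no facet at all, and the identity matrix does. *)
have [n0|n0] := posnP n.
  subst n; exists 1%:M; split=> [|x _]; first exact: unitmx1.
  exists 1; rewrite oner_eq0 mulmx1 scale1r; split=> //.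
  by rewrite (thinmx0 (g x)) (thinmx0 x).
rewrite -open_polytopeE in XE; rewrite -open_polytopeE in YE.
subst X; rewrite {}YE in Y0 YM gXY g_iso GX Hc.
have [i0 _] := has_facet X0 XM n0; have [j0 _] := has_facet Y0 YM n0.
have pX := bounded_positively_spanning X0 XM.
have pY := bounded_positively_spanning Y0 YM.
have gX x : open_polytope a b x -> open_polytope a' b' (g x).
  by move=> xX; rewrite -gXY; exists x.
have gY y : open_polytope a' b' y -> exists2 x, open_polytope a b x & g x = y.
  by rewrite -gXY.
have [v [vv vu]] := polytope_affine_basis X0 XM.
rewrite closure_open_polytope // in Gc GX.
rewrite closure_open_polytope // in GX Hc.
apply: (isometry_projective i0 j0 n0 pX pY gX gY _ Gc _ Gg vv vu X0 Hc Hg).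
- move=> x y xX yX; have := g_iso x y xX yX.
  rewrite (hilbert_distE X0 XM n0) // (hilbert_distE Y0 YM n0); try exact: gX.
  apply: ln_inj; rewrite posrE (lt_le_trans ltr01) // xratio_ge1 //; exact: gX.
- by move=> x xX; apply: GX; exists x.
Qed.
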